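(* Let $m,n\ge 1$, let $Y_1,\dots,Y_m\in\mathcal{C}^2(\mathbb{R}^n,\mathbb{R}^n)$ and let $x_0\in\mathbb{R}^n$. Then there exist $a_1,\dots,a_m>0$, with $D_j:=\prod_{i=1}^{j}(-a_i,a_i)$, open neighbourhoods $V(x_0)\subseteq V\subseteq\mathbb{R}^n$ of $x_0$, and vector fields with parameters $X_j(p_j;y)\in\mathbb{R}^n$, $p_j=(t_1,\dots,t_{j-1})\in D_{j-1}$, $y\in V$, $X_j\in\mathcal{C}^1(D_{j-1}\times V;\mathbb{R}^n)$, $j\in\{1,\dots,m\}$, with $X_1(y)=Y_1(y)$ (no parameter), such that the system $$\frac{\partial y}{\partial t_1}=Y_1(y),\quad \frac{\partial y}{\partial t_2}=X_2(t_1;y),\ \dots,\ \frac{\partial y}{\partial t_m}=X_m(t_1,\dots,t_{m-1};y)$$ is a gradient system, i.e. $\dfrac{\partial X_j}{\partial t_i}(p_j;y)=[X_i(p_i;\cdot),X_j(p_j;\cdot)](y)$ for all $1\le i<j\le m$, and $$G(p;x)=G_1(t_1)\circ\dots\circ G_m(t_m)(x),\qquad p=(t_1,\dots,t_m)\in D_m,\ x\in V(x_0),$$ is the solution of this system satisfying the Cauchy condition $y(0)=x\in V(x_0)$. Here $G_j(t)(x)$ denotes the local flow generated by the vector field $Y_j$, $j\in\{1,\dots,m\}$.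
   Context: The Lie bracket convention is $[Z_1,Z_2](y)=\frac{\partial Z_1}{\partial y}(y)Z_2(y)-\frac{\partial Z_2}{\partial y}(y)Z_1(y)$. The local flow of $Y_j$ is the map $G_j(t)(x)$ with $\frac{d}{dt}G_j(t)(x)=Y_j(G_j(t)(x))$, $G_j(0)(x)=x$, for $|t|$ small and $x$ near $x_0$. In general, a family $X_1(p;y),\dots,X_m(p;y)$ of $\mathcal{C}^1$ vector fields depending on $p=(t_1,\dots,t_m)$ is said to define a gradient system (Frobenius integrability condition) if $\frac{\partial X_j}{\partial t_i}-\frac{\partial X_i}{\partial t_j}=[X_i(p;\cdot),X_j(p;\cdot)]$ for all $i,j$. *)

(* Defs.v *)
From HB Require Import structures.
From mathcomp Require Import all_boot all_order all_algebra.
From mathcomp Require Import all_classical all_reals all_analysis.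
Import numFieldNormedType.Exports.

Set Implicit Arguments.
Unset Strict Implicit.
Unset Printing Implicit Defensive.

Local Open Scope classical_set_scope.
Local Open Scope ring_scope.

(* R^k is 'rV[R]_k with its sup norm; families indexed by 1..m are indexed    *)
(* here by 'I_m, so all indices are shifted by one.                           *)

(* f is C^k on the open set U. E is meant to be finite-dimensional, where     *)
(* continuity of every x |-> 'D_v f x is continuity of x |-> 'd f x. Only     *)
(* the values of f on U matter when U is open.                                *)
Fixpoint is_Ck (R : realType) (k : nat) (E F : normedModType R)
    (U : set E) (f : E -> F) : Prop :=
  match k with
  | 0 => forall x, U x -> {for x, continuous f}
  | k'.+1 => (forall x, U x -> differentiable f x) /\
             (forall v : E, is_Ck k' U ('D_v f))
  end.

Definition lie_bracket (R : realType) (n : nat)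
    (Z1 Z2 : 'rV[R]_n -> 'rV[R]_n) (y : 'rV[R]_n) : 'rV[R]_n :=
  'd Z1 y (Z2 y) - 'd Z2 y (Z1 y).

(* y is the value at time t of an integral curve of Y issued from x at time 0 *)
Definition flows_to (R : realType) (n : nat) (Y : 'rV[R]_n -> 'rV[R]_n)
    (t : R) (x y : 'rV[R]_n) : Prop :=
  exists (b c : R) (g : R -> 'rV[R]_n),
    [/\ b < 0 < c, b < t < c, g 0 = x,
        (forall s, b < s < c -> is_derive s (1 : R) g (Y (g s))) & g t = y].

Definition flow_defined (R : realType) (n : nat) (Y : 'rV[R]_n -> 'rV[R]_n)
    (t : R) (x : 'rV[R]_n) : Prop :=
  exists y, flows_to Y t x y.

(* Integral curves of a C^1 field are unique, so that the choice made by xget *)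
(* is immaterial; the value is x where the flow is not defined.               *)
Definition flow (R : realType) (n : nat) (Y : 'rV[R]_n -> 'rV[R]_n)
    (t : R) (x : 'rV[R]_n) : 'rV[R]_n :=
  xget x [set y | flows_to Y t x y].

(* For s = [:: j1; ..; jk], the point                                         *)
(* flow (Y j1) p_j1 (.. (flow (Y jk) p_jk x)).                                *)
Definition flow_comp (R : realType) (m n : nat)
    (Y : 'I_m -> 'rV[R]_n -> 'rV[R]_n) (s : seq 'I_m)
    (p : 'rV[R]_m) (x : 'rV[R]_n) : 'rV[R]_n :=
  foldr (fun j y => flow (Y j) (p 0 j) y) x s.

Definition box (R : realType) (k : nat) (a : 'rV[R]_k) : set 'rV[R]_k :=
  [set p | forall i, - a 0 i < p 0 i < a 0 i].

(* The parameters strictly preceding p_j. *)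
Definition params (R : realType) (m : nat) (j : 'I_m) (p : 'rV[R]_m) :
    'rV[R]_j :=
  \row_(i < j) p 0 (widen_ord (ltnW (ltn_ord j)) i).

Definition gradient_system (R : realType) (m n : nat)
    (X : 'I_m -> 'rV[R]_m -> 'rV[R]_n -> 'rV[R]_n)
    (D : set 'rV[R]_m) (V : set 'rV[R]_n) : Prop :=
  forall (i j : 'I_m) (p : 'rV[R]_m) (y : 'rV[R]_n), D p -> V y ->
    'D_(delta_mx 0 i) (fun q => X j q y) p
      - 'D_(delta_mx 0 j) (fun q => X i q y) p
    = lie_bracket (X i p) (X j p) y.

(* Classical (C^1) solutions on D of dy/dt_j = X_j(p; y), y(0) = x. *)
Definition is_solution (R : realType) (m n : nat)
    (X : 'I_m -> 'rV[R]_m -> 'rV[R]_n -> 'rV[R]_n)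
    (D : set 'rV[R]_m) (V : set 'rV[R]_n) (x : 'rV[R]_n)
    (y : 'rV[R]_m -> 'rV[R]_n) : Prop :=
  [/\ is_Ck 1 D y,
      (forall p, D p -> V (y p)),
      y 0 = x &
      forall (j : 'I_m) (p : 'rV[R]_m), D p ->
        'D_(delta_mx 0 j) y p = X j p (y p)].

(* Main.v *)
(** A flow [G_j] of a C^2 field [Y_j] is jointly C^1, and its tangent map is the
    flow of the C^1 field [(x, v) |-> (Y_j x, 'd Y_j x v)], hence is C^1 too. So the
    push-forward [X_j] of [Y_j] by [G_1(t_1) o .. o G_(j-1)(t_(j-1))] is C^1, and the
    chain rule gives [d G / d t_j = X_j(p; G)]. Since [x |-> G(p; x)] is onto near
    [x0], equality of the mixed derivatives of [G] in [t_i] and [t_j] is exactly the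
    gradient condition.

    Continuous differentiability near a point is handled as strict
    differentiability at all nearby points: this notion composes well, and a single
    Gronwall estimate on two nearby trajectories gives it for a flow. *)
Require Import Defs.
From HB Require Import structures.
From mathcomp Require Import all_boot all_order all_algebra.
From mathcomp Require Import all_classical all_reals all_analysis.
From mathcomp Require Import ring lra.
Import Order.TTheory GRing.Theory Num.Theory.
Import numFieldNormedType.Exports.

Set Implicit Arguments.
Unset Strict Implicit.
Unset Printing Implicit Defensive.

Local Open Scope classical_set_scope.
Local Open Scope ring_scope.

(** * Equalities in abelian groups *)

(** The push-forward is defined through flows only: its vector part is carried by the flow of the
    tangent field in dimension [n + n], not by a derivative of a flow. The theorem on local flows,
    which concerns a C^1 field, is thus applied twice, to [Y j] and to its tangent field, and [X_j]
    becomes C^1 as a composition. Mixed derivatives of [G] in the parameters exist because the first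
    ones are [X_j(p; G)], which is C^1 along with [X_j] and [G]. Since [flow] is total with a
    default value, undoing a flow is legitimate only where that flow is defined. The statements on
    compositions are therefore germs, valid for all [(p, x)] near [(0, x0)], and finitely many
    neighbourhoods are intersected at the end. *)

Inductive zterm := ZVar of nat | ZAdd of zterm & zterm | ZOpp of zterm | ZZero.

Section ZtermEval.
Variable V : zmodType.

Fixpoint zeval (s : seq V) (e : zterm) : V :=
  match e with
  | ZVar i => s`_i
  | ZAdd e1 e2 => zeval s e1 + zeval s e2
  | ZOpp e1 => - zeval s e1
  | ZZero => 0
  end.

Fixpoint zcoef (e : zterm) (i : nat) : int :=
  match e with
  | ZVar j => (i == j)%:R
  | ZAdd e1 e2 => zcoef e1 i + zcoef e2 i
  | ZOpp e1 => - zcoef e1 i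
  | ZZero => 0
  end.

(** A variable beyond [size s] evaluates to the default [0] of [nth], so the coefficients of the
    listed atoms determine the value. *)
Lemma zevalE s e : zeval s e = \sum_(i < size s) s`_i *~ zcoef e i.
Proof.
elim: e => [j|e1 IH1 e2 IH2|e IH|] /=.
- have [js|sj] := ltnP j (size s).
    rewrite (bigD1 (Ordinal js))//= eqxx mulr1z big1 ?addr0// => i ij.
    by rewrite -val_eqE /= in ij; rewrite (negbTE ij) mulr0z.
  rewrite nth_default// big1// => i _.
  by rewrite ltn_eqF ?mulr0z// (leq_trans (ltn_ord i)).
- by rewrite IH1 IH2 -big_split; apply: eq_bigr => i _; rewrite mulrzDr.
- by rewrite IH -sumrN; apply: eq_bigr => i _; rewrite mulrNz.
- by rewrite big1// => i _; rewrite mulr0z.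
Qed.

Lemma zeval_eq s e1 e2 :
  all (fun i => zcoef e1 i == zcoef e2 i) (iota 0 (size s)) ->
  zeval s e1 = zeval s e2.
Proof.
move=> /allP h; rewrite !zevalE; apply: eq_bigr => i _.
by rewrite (eqP (h i _))// mem_iota /= add0n.
Qed.

End ZtermEval.

(** The matches on [Set] let the test [eqt] run while a term is being built; its failure backtracks
    to the next branch. *)
Ltac zindex eqt x s :=
  lazymatch s with
  | cons ?y ?s' => match constr:(Set) with
                   | _ => let _ := match constr:(Set) with _ => eqt x y end in
                          constr:(O)
                   | _ => let k := zindex eqt x s' in constr:(S k)
                   end
  end.
Ltac zinsert eqt x s :=
  lazymatch s with
  | nil => constr:(cons x nil)
  | cons ?y ?s' => match constr:(Set) with
                   | _ => let _ := match constr:(Set) with _ => eqt x y end in s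
                   | _ => let r := zinsert eqt x s' in constr:(cons y r)
                   end
  end.
Ltac zatoms eqt t s :=
  lazymatch t with
  | (?a + ?b)%R => let s1 := zatoms eqt a s in zatoms eqt b s1
  | (- ?a)%R => zatoms eqt a s
  | 0%R => s
  | _ => zinsert eqt t s
  end.
Ltac zreify eqt t s :=
  lazymatch t with
  | (?a + ?b)%R =>
    let u := zreify eqt a s in let v := zreify eqt b s in constr:(ZAdd u v)
  | (- ?a)%R => let u := zreify eqt a s in constr:(ZOpp u)
  | 0%R => constr:(ZZero)
  | _ => let k := zindex eqt t s in constr:(ZVar k)
  end.
Ltac zmod_with eqt :=
  lazymatch goal with
  | |- @eq ?V ?x ?y =>
    let s0 := zatoms eqt x (@nil V) in let s := zatoms eqt y s0 in
    let u := zreify eqt x s in let v := zreify eqt y s in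
    apply: (@zeval_eq _ s u v); vm_compute; reflexivity
  end.
(* Decides equalities that hold in every abelian group ([ring] only handles
   rings). Comparing atoms up to unification may diverge, but is needed when
   two occurrences of an atom differ by the choice of canonical instances. *)
Ltac zmod :=
  first [ zmod_with ltac:(fun x y => constr_eq x y)
        | zmod_with ltac:(fun x y => unify x y) ].

Lemma ler_norm_split (R : realType) (V : normedModType R) (x a b : V) (r s : R) :
  x = a + b -> `|a| <= r -> `|b| <= s -> `|x| <= r + s.
Proof. by move=> -> ar bs; rewrite (le_trans (ler_normD _ _))// lerD. Qed.

Lemma eq_ler_norm (R : realType) (V : normedModType R) (x y : V) :
  x = y -> `|x| <= `|y|.
Proof. by move=> ->. Qed.

(** * Strict differentiability *)

(** Both [a] and [b] move, unlike in Frechet differentiability: this yields local Lipschitz bounds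
    and continuity of the derivative. The constant [K] expresses continuity of [df], which is a bare
    function so that explicit formulas can be supplied for it. *)
Definition sdiff (R : realType) (E F : normedModType R) (f : E -> F) (z : E)
    (df : E -> F) : Prop :=
  [/\ linear df,
      exists K, 0 < K /\ forall v, `|df v| <= K * `|v| &
      forall e, 0 < e -> exists2 d, 0 < d & forall a b,
        `|a - z| < d -> `|b - z| < d -> `|f a - f b - df (a - b)| <= e * `|a - b|].

Definition C1at (R : realType) (E F : normedModType R) (f : E -> F) (z : E) :=
  \forall z' \near z, exists df, sdiff f z' df.

Section Sdiff.
Context {R : realType}.
Implicit Types E F G : normedModType R.

Let half_gt0 (e : R) : 0 < e -> 0 < e / 2.
Proof. by move=> e0; rewrite divr_gt0. Qed.

Lemma near_norm E (z : E) (P : E -> Prop) :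
  (\forall y \near z, P y) <-> exists2 d, 0 < d & forall y, `|y - z| < d -> P y.
Proof.
rewrite nbhs_normP; split=> -[d d0 dP]; exists d => //= y.
  by rewrite distrC; apply: dP.
by rewrite /ball_ /= distrC; apply: dP.
Qed.

Lemma near_dist_le E F (f : E -> F) z e : {for z, continuous f} -> 0 < e ->
  \forall y \near z, `|f y - f z| <= e.
Proof. by move=> /cvgrPdistC_le; apply. Qed.

Lemma ler_eps_norm E (v : E) : (forall e, 0 < e -> `|v| <= e) -> v = 0.
Proof.
move=> ve; apply/normr0_eq0/eqP; rewrite eq_le normr_ge0 andbT.
by apply/ler_addgt0Pr => e e0; rewrite add0r; apply: ve.
Qed.

Lemma sdiff_is_diff E F (f : E -> F) z df : sdiff f z df -> is_diff z f df.
Proof.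
move=> [dflin [K [K0 dfK]] fE].
pose dfL : {linear E -> F} := HB.pack_for {linear E -> F} df
  (GRing.isLinear.Build _ _ _ _ df dflin).
have dfc : continuous dfL.
  apply/linear_bounded_continuous/linear_boundedP; near=> M => v.
  apply: (le_trans (dfK v)); rewrite ler_wpM2r//.
have fo : f \o shift z = cst (f z) + dfL +o_ 0 id.
  apply/eqaddoP => e e0; have [d d0 dP] := fE e e0.
  apply/near_norm; exists d => // v; rewrite subr0 => vd /=.
  have := dP (v + z) z; rewrite addrK subrr normr0 => /(_ vd d0).
  by rewrite /= !fctE opprD addrA.
have dE := diff_unique dfc fo.
split=> //; apply/diff_locallyP; split; rewrite dE//.
Unshelve. all: by end_near. Qed.

Lemma sdiff_diff E F (f : E -> F) z df : sdiff f z df -> differentiable f z.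
Proof. by move=> /sdiff_is_diff[]. Qed.

Lemma sdiff_val E F (f : E -> F) z df : sdiff f z df -> 'd f z = df :> (E -> F).
Proof. by move=> /sdiff_is_diff[]. Qed.

Lemma sdiff_derive E F (f : E -> F) z df v : sdiff f z df -> 'D_v f z = df v.
Proof. by move=> h; rewrite deriveE ?(sdiff_val h)//; exact: sdiff_diff h. Qed.

Lemma sdiff_cont E F (f : E -> F) z df : sdiff f z df -> {for z, continuous f}.
Proof. by move=> /sdiff_diff/differentiable_continuous. Qed.

(** By homogeneity [df] may be tested on [h *: v], with [h] so small that [h *: v + z] lies in both
    balls; after division by [h] the strict remainder contributes only [r]. *)
Lemma sdiff_le E F (f : E -> F) z df e d : sdiff f z df ->
  (forall a b, `|a - z| < d -> `|b - z| < d ->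
     `|f a - f b| <= e * `|a - b|) -> 0 < d ->
  forall v, `|df v| <= e * `|v|.
Proof.
move=> [dflin _ fE] H d0 v.
have dfZ r w : df (r *: w) = r *: df w.
  by have /(_ r w 0) := dflin; rewrite !addr0 => ->;
     have /(_ 1 0 0) := dflin; rewrite !scale1r addr0 => /(congr1 (fun u => u - df 0));
     rewrite addrK subrr => <-; rewrite addr0.
have [->|v0] := eqVneq v 0.
  by have /(_ 0 0) := dfZ; rewrite !scale0r => ->; rewrite !normr0 mulr0.
have nv : 0 < `|v| by rewrite normr_gt0.
apply/ler_addgt0Pr => r r0.
have [d' d'0 dP] := fE (r / `|v|) (divr_gt0 r0 nv).
have [h h0 hv] : exists2 h, 0 < h & `|h *: v| < Num.min d d'.
  have m0 : 0 < Num.min d d' by rewrite lt_min d0.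
  exists (Num.min d d' / (2 * `|v|)); first by rewrite divr_gt0// mulr_gt0.
  rewrite normrZ gtr0_norm ?divr_gt0 ?mulr_gt0// invfM mulrA mulfVK ?gt_eqF//.
  lra.
move: (hv); rewrite lt_min => /andP[hvd hvd'].
have z0 : `|z - z| = 0 by rewrite subrr normr0.
have := dP (h *: v + z) z; rewrite addrK z0 => /(_ hvd' d'0).
have := H (h *: v + z) z; rewrite addrK z0 => /(_ hvd d0) H1 H2.
have : `|df (h *: v)| <= (e + r / `|v|) * `|h *: v|.
  rewrite mulrDl; apply: le_trans (lerD H1 H2).
  by rewrite -[X in `|X|](subKr (f (h *: v + z) - f z)) ler_normB.
rewrite dfZ !normrZ mulrCA ler_pM2l ?gtr0_norm//.
by rewrite mulrDl divfK ?gt_eqF.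
Qed.

Lemma linear_sub E F (f g : E -> F) : linear f -> linear g ->
  linear (fun x => f x - g x).
Proof. by move=> fl gl a u v; rewrite fl gl scalerBr; zmod. Qed.

Lemma lin0 E F (f : E -> F) : linear f -> f 0 = 0.
Proof.
move=> fl; have := fl 1 0 0; rewrite !scale1r addr0 => /(congr1 (fun u => u - f 0)).
by rewrite subrr addrK => <-.
Qed.

Lemma linZ E F (f : E -> F) r v : linear f -> f (r *: v) = r *: f v.
Proof. by move=> fl; have := fl r v 0; rewrite (lin0 fl) !addr0. Qed.

Lemma linD E F (f : E -> F) u v : linear f -> f (u + v) = f u + f v.
Proof. by move=> fl; have := fl 1 u v; rewrite !scale1r. Qed.

Lemma linB E F (f : E -> F) u v : linear f -> f (u - v) = f u - f v.
Proof. by move=> fl; rewrite -scaleN1r linD// linZ// scaleN1r. Qed.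

Lemma sdiff_lin E F (f : E -> F) K z :
  linear f -> (forall v, `|f v| <= K * `|v|) -> sdiff f z f.
Proof.
move=> fl fK; split=> //.
  exists (`|K| + 1); split; first by rewrite ltr_wpDl.
  move=> v; apply: (le_trans (fK v)); rewrite ler_wpM2r//.
  by rewrite (le_trans (ler_norm K))// lerDl.
move=> e e0; exists 1 => // a b _ _.
by rewrite (linB _ _ fl) subrr normr0 mulr_ge0// ltW.
Qed.

Lemma sdiff_cst E F (c : F) (z : E) : sdiff (fun=> c) z (fun=> 0).
Proof.
split=> [a u v||e e0]; first by rewrite scaler0 addr0.
  by exists 1; split=> // v; rewrite normr0 mul1r.
by exists 1 => // a b _ _; rewrite !subrr normr0 mulr_ge0// ltW.
Qed.

Lemma sdiff_id E (z : E) : sdiff id z id.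
Proof. by apply: (@sdiff_lin _ _ _ 1) => // v; rewrite mul1r. Qed.

Lemma sdiffB E F (f g : E -> F) z df dg : sdiff f z df -> sdiff g z dg ->
  sdiff (fun x => f x - g x) z (fun v => df v - dg v).
Proof.
move=> [fl [K [K0 fK]] fE] [gl [L [L0 gL]] gE]; split.
- exact: linear_sub.
- exists (K + L); split=> [|v]; first exact: addr_gt0.
  by rewrite mulrDl (le_trans (ler_normB _ _))// lerD.
move=> e e0; have e2 : 0 < e / 2 by rewrite divr_gt0.
have [d d0 dP] := fE _ e2; have [d' d'0 d'P] := gE _ e2.
exists (Num.min d d'); first by rewrite lt_min d0.
move=> a b; rewrite !lt_min => /andP[ad ad'] /andP[bd bd'].
rewrite (splitr e) mulrDl; apply: le_trans (lerD (dP _ _ ad bd) (d'P _ _ ad' bd')).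
rewrite -[X in _ <= _ + X]normrN.
apply: (@ler_norm_split _ _ _ (f a - f b - df (a - b))
  (- (g a - g b - dg (a - b)))) => //; zmod.
Qed.

(** [df' - df] is the derivative at [z'] of [f - df], which is [e]-Lipschitz around [z'] by the
    strict estimate at [z]. Hence strict derivatives, where they exist, vary continuously. *)
Lemma sdiff_near E F (f : E -> F) z df : sdiff f z df ->
  forall e, 0 < e -> \forall z' \near z, forall df', sdiff f z' df' ->
    forall v, `|df' v - df v| <= e * `|v|.
Proof.
move=> [fl [K [K0 fK]] fE] e e0; have [d d0 dP] := fE e e0.
apply/near_norm; exists d => // z' zd df' hf'.
have hg := sdiffB hf' (sdiff_lin z' fl fK).
apply: (@sdiff_le _ _ _ _ _ e (d - `|z' - z|) hg); last by rewrite subr_gt0.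
have aux a : `|a - z'| < d - `|z' - z| -> `|a - z| < d.
  rewrite ltrBrDr; apply: le_lt_trans.
  by apply: (@ler_norm_split _ _ _ (a - z') (z' - z)) => //; zmod.
move=> a b /aux ad /aux bd; apply: le_trans (dP a b ad bd).
by rewrite (linB _ _ fl) /=; apply: eq_ler_norm; zmod.
Qed.

Lemma sdiff_lip E F (f : E -> F) z df : sdiff f z df ->
  exists L d, [/\ 0 < L, 0 < d & forall a b, `|a - z| < d -> `|b - z| < d ->
     `|f a - f b| <= L * `|a - b|].
Proof.
move=> [fl [K [K0 fK]] fE]; have [d d0 dP] := fE 1 ltr01.
exists (1 + K), d; split=> //; first exact: addr_gt0.
move=> a b az bz; rewrite mulrDl.
apply: (ler_norm_split _ (dP a b az bz) (fK (a - b))); zmod.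
Qed.

Lemma sdiff_comp E F G (f : E -> F) (g : F -> G) z df dg :
  sdiff f z df -> sdiff g (f z) dg -> sdiff (g \o f) z (dg \o df).
Proof.
move=> hf [gl [L [L0 gL]] gE]; have [fl [K [K0 fK]] fE] := hf.
have [M [d1 [M0 d10 fM]]] := sdiff_lip hf.
split.
- by move=> a u v /=; rewrite fl gl.
- exists (L * K); split=> [|v /=]; first exact: mulr_gt0.
  by rewrite -mulrA (le_trans (gL _))// ler_pM2l.
move=> e e0.
have [d2 d20 gd] := gE (e / 2 / M) (divr_gt0 (half_gt0 e0) M0).
have [d3 d30 fd] := fE (e / 2 / L) (divr_gt0 (half_gt0 e0) L0).
pose d := Num.min d1 (Num.min d3 (d2 / M)).
exists d; first by rewrite !lt_min d10 d30 divr_gt0.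
have fz a : `|a - z| < d -> `|f a - f z| < d2.
  rewrite !lt_min => /and3P[ad1 ad3]; rewrite ltr_pdivlMr// mulrC => ad2.
  by apply: le_lt_trans ad2; apply: fM => //; rewrite subrr normr0.
move=> a b ad bd.
have := gd _ _ (fz a ad) (fz b bd).
move: ad bd; rewrite !lt_min => /and3P[ad1 ad3 _] /and3P[bd1 bd3 _] h1.
rewrite (splitr e) mulrDl.
(* The remainder of [g] at the images, controlled through the Lipschitz constant [M] of [f], plus
   [dg] applied to the remainder of [f]. *)
apply: (@ler_norm_split _ _ _ (g (f a) - g (f b) - dg (f a - f b))
  (dg (f a - f b - df (a - b)))).
- by rewrite (linB _ (df _) gl) /=; zmod.
- apply: (le_trans h1).
  rewrite -mulrA; apply: ler_wpM2l; first exact/ltW/half_gt0.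
  by rewrite ler_pdivrMl// fM.
- apply: (le_trans (gL _)); rewrite -ler_pdivlMl// mulrA [L^-1 * _]mulrC.
  exact: fd.
Qed.

Lemma sdiff_pair E F G (f : E -> F) (g : E -> G) z df dg :
  sdiff f z df -> sdiff g z dg ->
  sdiff (fun x => (f x, g x)) z (fun v => (df v, dg v)).
Proof.
move=> [fl [K [K0 fK]] fE] [gl [L [L0 gL]] gE]; split.
- by move=> a u v; rewrite fl gl.
- exists (Num.max K L); split; first by rewrite lt_max K0.
  move=> v; rewrite prod_normE ge_max; apply/andP; split.
    by apply: (le_trans (fK v)); rewrite ler_wpM2r// le_max lexx.
  by apply: (le_trans (gL v)); rewrite ler_wpM2r// le_max lexx orbT.
move=> e e0; have [d d0 dP] := fE _ e0; have [d' d'0 d'P] := gE _ e0.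
exists (Num.min d d'); first by rewrite lt_min d0.
move=> a b; rewrite !lt_min => /andP[ad ad'] /andP[bd bd'].
by rewrite prod_normE ge_max /= dP// d'P.
Qed.

Lemma sdiff_scale E F (k : E -> R) (f : E -> F) z dk df :
  sdiff k z dk -> sdiff f z df ->
  sdiff (fun x => k x *: f x) z (fun v => k z *: df v + dk v *: f z).
Proof.
move=> hk hf.
have [kl [K [K0 kK]] kE] := hk; have [fl [L [L0 fL]] fE] := hf.
(* Scalar multiplication is bilinear: its remainder at [(k z, f z)] is a sum of two products, each
   with one factor below [e / 2]. *)
suff h : sdiff (fun q : R * F => q.1 *: q.2) (k z, f z)
    (fun q : R * F => k z *: q.2 + q.1 *: f z).
  exact: sdiff_comp (sdiff_pair hk hf) h.
split.
- by move=> a u v /=; rewrite scalerDl !scalerDr !scalerA [a * _]mulrC; zmod.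
- exists (`|k z| + `|f z| + 1); split; first by rewrite ltr_wpDl// addr_ge0.
  move=> v; rewrite !mulrDl mul1r.
  apply: (@le_trans _ _ (`|k z| * `|v| + `|f z| * `|v|)); last by rewrite lerDl.
  apply: ler_norm_split => //.
    by rewrite normrZ ler_wpM2l// prod_normE le_max lexx orbT.
  by rewrite normrZ mulrC ler_wpM2l// prod_normE le_max lexx.
move=> e e0; exists (e / 2); first by rewrite divr_gt0.
move=> [a1 a2] [b1 b2]; rewrite !prod_normE /= !gt_max => /andP[a1d a2d] /andP[b1d b2d].
rewrite (splitr e) mulrDl.
apply: (@ler_norm_split _ _ _ ((a1 - k z) *: (a2 - b2)) ((a1 - b1) *: (b2 - f z))).
- by rewrite !scalerBr !scalerBl; zmod.
- rewrite normrZ; apply: ler_pM => //; first exact: ltW.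
  by rewrite le_max lexx orbT.
- rewrite normrZ mulrC; apply: ler_pM => //; first exact: ltW.
  by rewrite le_max lexx.
Qed.

Lemma sdiffN E F (f : E -> F) z df : sdiff f z df ->
  sdiff (fun x => - f x) z (fun v => - df v).
Proof.
move=> hf; have := sdiffB (sdiff_cst (0 : F) z) hf.
by under eq_fun do rewrite sub0r; under [X in sdiff _ _ X]eq_fun do rewrite sub0r.
Qed.

Lemma sdiffD E F (f g : E -> F) z df dg : sdiff f z df -> sdiff g z dg ->
  sdiff (fun x => f x + g x) z (fun v => df v + dg v).
Proof.
move=> hf hg; have := sdiffB hf (sdiffN hg).
by under eq_fun do rewrite opprK; under [X in sdiff _ _ X]eq_fun do rewrite opprK.
Qed.

Lemma sdiff_sum E F (I : Type) (s : seq I) (f : I -> E -> F) z df :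
  (forall i, sdiff (f i) z (df i)) ->
  sdiff (fun x => \sum_(i <- s) f i x) z (fun v => \sum_(i <- s) df i v).
Proof.
move=> h; elim: s => [|i s IH].
  under eq_fun do rewrite big_nil; under [X in sdiff _ _ X]eq_fun do rewrite big_nil.
  exact: sdiff_cst.
under eq_fun do rewrite big_cons; under [X in sdiff _ _ X]eq_fun do rewrite big_cons.
exact: sdiffD.
Qed.

Lemma C1at_sdiff E F (f : E -> F) z : C1at f z -> exists df, sdiff f z df.
Proof. exact: nbhs_singleton. Qed.

Lemma C1at_cont E F (f : E -> F) z : C1at f z -> {for z, continuous f}.
Proof. by move=> /C1at_sdiff[df /sdiff_cont]. Qed.

Lemma C1at_near E F (f : E -> F) z (P : set F) : C1at f z -> nbhs (f z) P ->
  nbhs z [set x | P (f x)].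
Proof. by move=> /C1at_cont; apply. Qed.

(** The way back to [is_Ck]: directional derivatives are continuous by [sdiff_near], applied with a
    tolerance scaled by the norm of [v] plus one. *)
Lemma C1at_is_Ck E F (f : E -> F) (U : set E) :
  (forall z, U z -> C1at f z) -> is_Ck 1 U f.
Proof.
move=> Uf; split=> [z Uz|v z Uz].
  by have [df] := C1at_sdiff (Uf z Uz); exact: sdiff_diff.
have [df hf] := C1at_sdiff (Uf z Uz).
apply/cvgrPdist_le => e e0.
have e1 : 0 < e / (`|v| + 1) by rewrite divr_gt0// ltr_wpDl.
near=> z'.
have [df' hf'] : exists df', sdiff f z' df' by near: z'; exact: Uf.
rewrite (sdiff_derive _ hf) (sdiff_derive _ hf') distrC.
apply: (@le_trans _ _ (e / (`|v| + 1) * `|v|)).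
  have h : forall df0, sdiff f z' df0 ->
      forall w, `|df0 w - df w| <= e / (`|v| + 1) * `|w|.
    by near: z'; exact: sdiff_near hf _ e1.
  exact: h.
by rewrite mulrAC ler_pdivrMr ?ltr_wpDl// ler_pM2l// lerDl.
Unshelve. all: by end_near. Qed.

Lemma C1at_comp E F G (f : E -> F) (g : F -> G) z :
  C1at f z -> C1at g (f z) -> C1at (g \o f) z.
Proof.
move=> hf hg; have fc := C1at_cont hf; near=> z'.
have [df hdf] : exists df, sdiff f z' df by near: z'.
have [dg hdg] : exists dg, sdiff g (f z') dg by near: z'; exact: (fc _ hg).
by exists (dg \o df); exact: sdiff_comp.
Unshelve. all: by end_near. Qed.

Lemma C1at_pair E F G (f : E -> F) (g : E -> G) z :
  C1at f z -> C1at g z -> C1at (fun x => (f x, g x)) z.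
Proof.
move=> hf hg; near=> z'.
have [df hdf] : exists df, sdiff f z' df by near: z'.
have [dg hdg] : exists dg, sdiff g z' dg by near: z'.
by exists (fun v => (df v, dg v)); exact: sdiff_pair.
Unshelve. all: by end_near. Qed.

Lemma C1at_lin E F (f : E -> F) K z :
  linear f -> (forall v, `|f v| <= K * `|v|) -> C1at f z.
Proof. by move=> fl fK; near=> z'; exists f; exact: sdiff_lin fK.
Unshelve. all: by end_near. Qed.

End Sdiff.

(** * Curves *)

Section Curves.
Context {R : realType} {n : nat}.
Implicit Types u : R -> 'rV[R]_n.

Lemma rV_norm_le (v : 'rV[R]_n) K :
  0 <= K -> (forall i, `|v 0 i| <= K) -> `|v| <= K.
Proof.
move=> K0 vK; rewrite [leLHS]/Num.Def.normr /= mx_normrE bigmax_le// => -[i j] _.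
by rewrite ord1.
Qed.

Lemma coord_norm_le (v : 'rV[R]_n) i : `|v 0 i| <= `|v|.
Proof.
rewrite [leRHS]/Num.Def.normr /= mx_normrE.
exact: (le_bigmax _ (fun ij : 'I_1 * 'I_n => `|v ij.1 ij.2|) (0, i)).
Qed.

Lemma is_derive_rowP (t : R) u (du : 'rV[R]_n) :
  is_derive t (1 : R) u du <->
  forall i, is_derive t (1 : R) (fun s => u s 0 i) (du 0 i).
Proof.
split=> [[ud uE] i|h].
  split; first by move/derivable_mxP : ud.
  by rewrite -uE derive_mx// mxE.
have ud : derivable u t 1.
  by apply/derivable_mxP => i j; rewrite ord1; have [] := h j.
split=> //; rewrite derive_mx//; apply/rowP => i; rewrite mxE.
by have [_ ->] := h i.
Qed.

Lemma is_derive1_cont (V : normedModType R) (u : R -> V) t du :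
  is_derive t (1 : R) u du -> {for t, continuous u}.
Proof. by move=> [/derivable1_diffP/differentiable_continuous]. Qed.

(** The sup norm reduces this to the scalar mean value theorem in each coordinate: the intermediate
    point varies with the coordinate, the bound [K] does not. *)
Lemma mean_value u (du : R -> 'rV[R]_n) (a b K : R) : a <= b ->
  (forall s, a <= s <= b -> is_derive s (1 : R) u (du s)) ->
  (forall s, a <= s <= b -> `|du s| <= K) -> `|u b - u a| <= K * (b - a).
Proof.
move=> ab ud duK.
have K0 : 0 <= K by rewrite (le_trans _ (duK a _))// lexx.
apply: rV_norm_le => [|i]; first by rewrite mulr_ge0// subr_ge0.
have [s|s|c] := @MVT_segment _ (fun s => u s 0 i) (fun s => du s 0 i) _ _ ab.
- by rewrite in_itv /= => /andP[/ltW as_ /ltW sb]; apply: (is_derive_rowP _ _ _).1; exact/ud/andP.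
- apply: derivable_within_continuous => {}s; rewrite in_itv /= => sab.
  by have /is_derive_rowP/(_ i)[] := ud s sab.
rewrite in_itv /= => cab; rewrite !mxE => ->.
rewrite normrM [X in _ * X]ger0_norm ?subr_ge0// ler_wpM2r ?subr_ge0//.
exact: le_trans (coord_norm_le _ _) (duK c cab).
Qed.

Lemma mean_value0 u (du : R -> 'rV[R]_n) (t K : R) :
  (forall s, `|s| <= `|t| -> is_derive s (1 : R) u (du s)) ->
  (forall s, `|s| <= `|t| -> `|du s| <= K) -> `|u t - u 0| <= K * `|t|.
Proof.
move=> ud duK; have [t0|t0] := leP 0 t.
  have le s : 0 <= s <= t -> `|s| <= `|t|.
    by move=> /andP[s0 st]; rewrite !ger0_norm.
  have := @mean_value u du 0 t K t0 (fun s h => ud s (le s h))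
    (fun s h => duK s (le s h)).
  by rewrite subr0 (ger0_norm t0).
have le s : t <= s <= 0 -> `|s| <= `|t|.
  by move=> /andP[ts s0]; rewrite !ler0_norm ?lerN2// ltW.
have := @mean_value u du t 0 K (ltW t0) (fun s h => ud s (le s h))
  (fun s h => duK s (le s h)).
by rewrite sub0r distrC (ltr0_norm t0).
Qed.

(* Gronwall's inequality on a short interval: with [L * `|t| <= 1 / 2], the
   maximum of [`|u|] can be absorbed in the left-hand side. *)
Lemma short_gronwall u (du : R -> 'rV[R]_n) (t L e : R) : 0 <= L -> 0 <= e -> L * `|t| <= 1 / 2 ->
  (forall s, `|s| <= `|t| -> is_derive s (1 : R) u (du s)) ->
  (forall s, `|s| <= `|t| -> `|du s| <= L * `|u s| + e) ->
  `|u t| <= 2 * (`|u 0| + e * `|t|).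
Proof.
move=> L0 e0 Lt ud duL.
have tt : - `|t| <= `|t| by rewrite (le_trans _ (normr_ge0 t))// oppr_le0.
have itv s : (s \in `[- `|t|, `|t|]%R) = (`|s| <= `|t|).
  by rewrite in_itv /= ler_norml.
have [|c] := @EVT_max _ (fun s => `|u s|) _ _ tt.
  apply: continuous_in_subspaceT => s; rewrite inE /= => /[!itv] st.
  by apply: continuous_comp; [exact: is_derive1_cont (ud s st)|exact: norm_continuous].
rewrite itv => ct cmax.
have h : `|u c - u 0| <= (L * `|u c| + e) * `|c|.
  apply: (@mean_value0 u du) => s sc; first by apply: ud; exact: le_trans ct.
  have st : `|s| <= `|t| by exact: le_trans ct.
  by apply: (le_trans (duL s st)); rewrite lerD2r ler_wpM2l// cmax// itv.
have h1 : `|u c| <= `|u 0| + (L * `|u c| + e) * `|c|.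
  by apply: (@ler_norm_split _ _ _ (u 0) (u c - u 0)) => //; zmod.
have h2 : `|u t| <= `|u c| by apply: cmax; rewrite itv.
have h3 : L * `|u c| * `|c| <= 1 / 2 * `|u c|.
  rewrite mulrAC ler_wpM2r//; apply: le_trans Lt.
  by rewrite ler_wpM2l.
have h4 : e * `|c| <= e * `|t| by rewrite ler_wpM2l.
by rewrite mulrDl in h1; lra.
Qed.

Lemma primitive (f : R -> 'rV[R]_n) A : 0 < A -> continuous f ->
  exists P : R -> 'rV[R]_n, P 0 = 0 /\
    forall s, `|s| < A -> is_derive s (1 : R) P (f s).
Proof.
move=> A0 fc.
suff h i : exists P : R -> R, P 0 = 0 /\
    forall s, `|s| < A -> is_derive s (1 : R) P (f s 0 i).
  have [P PE] := choice h.
  exists (fun s => \row_i P i s); split.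
    by apply/rowP => i; rewrite !mxE; have [] := PE i.
  move=> s sA; apply/is_derive_rowP => i.
  under eq_fun do rewrite mxE.
  exact: (PE i).2.
have gc : continuous (fun s => f s 0 i).
  move=> s; apply: (@continuous_comp _ _ _ f (fun v : 'rV[R]_n => v 0 i)).
    exact: fc.
  exact: coord_continuous.
(* The integral starts at [- A] so that [0] and the negative times are interior; subtracting [F 0]
   restores the initial condition. *)
pose F := fun x => (\int[lebesgue_measure]_(t in `[- A, x]) (f t 0 i))%R.
exists (fun s => F s - F 0); split; first by rewrite subrr.
move=> s; rewrite ltr_norml => /andP[As sA].
have fi : lebesgue_measure.-integrable `[- A, A] (EFin \o (fun s => f s 0 i)).
  apply: continuous_compact_integrable; first exact: segment_compact.
  exact: continuous_subspaceT.
have [Fd FE] := continuous_FTC1_closed sA fi As (gc s).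
have FD : is_derive s (1 : R) F (f s 0 i) by split; [exact: Fd|rewrite -derive1E FE].
by rewrite -[f s 0 i]subr0; apply: is_deriveB.
Qed.

End Curves.

(** * Integral curves *)

Section Picard.
Context {R : realType} {n : nat}.
Implicit Types g : R -> 'rV[R]_n.

Lemma near_half_pow (r e : R) : 0 < e -> exists k, r / 2 ^+ k <= e.
Proof.
move=> e0; have h2 : `|2^-1 : R| < 1 by rewrite ger0_norm// invf_lt1// ltr1n.
have e1 : 0 < e / (`|r| + 1) by rewrite divr_gt0// ltr_wpDl.
have /cvgrPdist_le/(_ _ e1)[k _ /(_ k (leqnn k))] := cvg_expr h2.
rewrite /= sub0r normrN exprVn ger0_norm ?invr_ge0 ?exprn_ge0// => h.
exists k; apply: (@le_trans _ _ (`|r| / 2 ^+ k)).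
  by rewrite ler_wpM2r ?invr_ge0 ?exprn_ge0// ler_norm.
apply: (@le_trans _ _ (`|r| * (e / (`|r| + 1)))); first by rewrite ler_wpM2l.
by rewrite mulrA ler_pdivrMr ?ltr_wpDl// mulrC ler_pM2l// lerDl.
Qed.

Lemma geometric_limit (V : completeNormedModType R) (u : V ^nat) r :
  (forall k, `|u k.+1 - u k| <= r / 2 ^+ k) ->
  exists l, forall k, `|u k - l| <= (r * 2) / 2 ^+ k.
Proof.
move=> ur; have r0 : 0 <= r.
  by have := ur 0%N; rewrite expr0 divr1; apply: le_trans.
(* The subtracted tail of the geometric sum is what makes the induction on [j] close. *)
have uP k j : `|u (k + j)%N - u k| <= r * 2 / 2 ^+ k - r * 2 / 2 ^+ (k + j).
  elim: j => [|j IH]; first by rewrite addn0 !subrr normr0.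
  have := @ler_norm_split _ _ (u (k + j.+1)%N - u k) (u (k + j).+1 - u (k + j)%N)
    (u (k + j)%N - u k) _ _ _ (ur (k + j)%N) IH.
  rewrite addnS => /(_ ltac:(zmod)) /le_trans; apply.
  rewrite [in leRHS]exprS invfM; set a := r; set b := (2 ^+ (k + j))^-1.
  by set c := _ / 2 ^+ k; rewrite le_eqVlt; apply/orP; left; apply/eqP; field.
have /cvg_ex[/= l ul] : cvgn u.
  rewrite (_ : u = fun k => u 0%N + series (telescope u) k); last first.
    by apply/funext => k; exact: eq_sum_telescope.
  apply: is_cvgD; first exact: is_cvg_cst.
  apply: normed_cvg; apply: (@series_le_cvg _ _ (geometric r 2^-1)).
  - by move=> k /=.
  - by move=> k /=; rewrite mulr_ge0// exprn_ge0// invr_ge0.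
  - move=> k; rewrite /= exprVn; exact: ur.
  - by apply: is_cvg_geometric_series; rewrite ger0_norm// invf_lt1// ltr1n.
exists l => k; apply/ler_addgt0Pr => e e0.
have /cvgrPdist_le/(_ _ e0)[j _ /(_ (k + j)%N (leq_addl _ _))] := ul.
rewrite /= => h; rewrite [leRHS]addrC.
apply: (@ler_norm_split _ _ _ (- (l - u (k + j)%N)) (u k - u (k + j)%N)).
- zmod.
- by rewrite normrN.
rewrite distrC; apply: (le_trans (uP _ _)).
by rewrite lerBlDr lerDl divr_ge0// ?exprn_ge0// mulr_ge0.
Qed.

Lemma geometric_limit_rV (u : ('rV[R]_n)^nat) r :
  (forall k, `|u k.+1 - u k| <= r / 2 ^+ k) ->
  exists l, forall k, `|u k - l| <= (r * 2) / 2 ^+ k.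
Proof.
move=> ur; have r0 : 0 <= r.
  by have := ur 0%N; rewrite expr0 divr1; apply: le_trans.
have h i : exists l : R, forall k, `|u k 0 i - l| <= (r * 2) / 2 ^+ k.
  apply: (@geometric_limit R (fun k => u k 0 i)) => k; apply: le_trans (ur k).
  by have := coord_norm_le (u k.+1 - u k) i; rewrite !mxE.
have [l lP] := choice h.
exists (\row_i l i) => k; apply: rV_norm_le => [|i].
  by rewrite divr_ge0 ?exprn_ge0// mulr_ge0.
by rewrite !mxE.
Qed.

(** Freezing time outside [[- d, d]] lets the Picard operator act on curves that are continuous on
    the whole line. *)
Definition clamp (d t : R) := Num.max (- d) (Num.min d t).

Lemma clamp_le d t : 0 <= d -> `|clamp d t| <= d.
Proof.
move=> d0; rewrite ler_norml /clamp le_max lexx /= ge_max ge_min lexx andbT.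
by rewrite (le_trans _ d0)// oppr_le0.
Qed.

Lemma clamp_id d t : `|t| <= d -> clamp d t = t.
Proof.
by rewrite ler_norml => /andP[dt td]; rewrite /clamp (min_idPr td) (max_idPr dt).
Qed.

Lemma clamp_continuous d : 0 <= d -> continuous (clamp d).
Proof.
move=> d0 t; apply/cvgrPdist_le => e e0; apply/nbhs_normP; exists e => // s /ltW.
apply: le_trans; rewrite /clamp !maxEle !minEle.
have dd : - d <= d by lra.
do ?case: ifP => /negP/negP; rewrite ?negbK -?ltNge => *;
  rewrite ler_norml; have := ler_norm (t - s); have := ler_norm (s - t);
  rewrite [`|s - t|]distrC; lra.
Qed.

(** The field depends on time because the lemma serves both the autonomous equation of [Z] and the
    linear variational equation along a trajectory. [L * d <= 1 / 2] halves distances, the bound on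
    [F t y] keeps the iterates in the ball, and continuity of [F] is expressed along curves with
    clamped time. *)
Lemma picard (F : R -> 'rV[R]_n -> 'rV[R]_n) x d L r :
  0 < d -> 0 <= r -> 0 <= L -> L * d <= 1 / 2 ->
  (forall t y z, `|t| <= d -> `|y - x| <= r -> `|z - x| <= r ->
     `|F t y - F t z| <= L * `|y - z|) ->
  (forall t y, `|t| <= d -> `|y - x| <= r -> `|F t y| * d <= r) ->
  (forall g, continuous g -> (forall s, `|g s - x| <= r) ->
     continuous (fun s => F (clamp d s) (g s))) ->
  exists g, [/\ g 0 = x, forall t, `|t| <= d -> `|g t - x| <= r &
    forall t, `|t| < d -> is_derive t (1 : R) g (F t (g t))].
Proof.
move=> d0 r0 L0 Ld FL Fr Fc; have d1 : d < d + 1 by rewrite ltrDl.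
have dge0 := ltW d0.
(* Choosing a primitive for every [f], with the junk value [0] when [f] is not continuous, makes [P]
   a total operator. *)
have prim0 (f : R -> 'rV[R]_n) : exists P : R -> 'rV[R]_n, continuous f ->
    P 0 = 0 /\ forall s, `|s| < d + 1 -> is_derive s (1 : R) P (f s).
  have [fc|nfc] := pselect (continuous f); last by exists 0.
  by have [P h] := primitive (lt_trans d0 d1) fc; exists P.
have {prim0}[P PE] := choice prim0.
(* The margin [1] makes the primitives differentiable at the extreme clamped times [- d] and [d] as
   well. *)
have clP t : `|clamp d t| < d + 1 by rewrite (le_lt_trans (clamp_le _ _)).
pose f (c : R -> 'rV[R]_n) s := F (clamp d s) (c s).
pose T (c : R -> 'rV[R]_n) (t : R) : 'rV[R]_n := x + P (f c) (clamp d t).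
pose good (c : R -> 'rV[R]_n) := continuous c /\ forall s, `|c s - x| <= r.
have le_cl s t : `|s| <= `|clamp d t| -> `|s| < d + 1.
  by move=> st; rewrite (le_lt_trans st).
have fcont c : good c -> continuous (f c) by case=> cc cr; exact: Fc.
have Tgood c : good c -> good (T c).
  move=> gc; have [cc cr] := gc; have [P0 Pd] := PE _ (fcont c gc); split=> [t|t].
    apply: cvgD; first exact: cvg_cst.
    apply: (@continuous_comp _ _ _ (clamp d) (P (f c))).
      exact: clamp_continuous.
    exact: is_derive1_cont (Pd _ (clP t)).
  rewrite /T addrAC subrr add0r -[P _ _]subr0 -P0.
  have := @mean_value0 _ _ (P (f c)) (f c) (clamp d t) (r / d).
  move=> /(_ _ _)/le_trans; apply.
  - by move=> s /le_cl; exact: Pd.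
  - by move=> s _; rewrite ler_pdivlMr//; apply: Fr => //; exact: clamp_le.
  by rewrite mulrAC ler_pdivrMr// ler_wpM2l// clamp_le.
have Tcontr c c' e : good c -> good c' -> (forall s, `|c s - c' s| <= e) ->
    forall t, `|T c t - T c' t| <= e / 2.
  move=> gc gc' ce t; have [P0 Pd] := PE _ (fcont c gc).
  have [P0' Pd'] := PE _ (fcont c' gc').
  have e0 : 0 <= e by rewrite (le_trans _ (ce 0)).
  rewrite (_ : T c t - T c' t = (P (f c) (clamp d t) - P (f c') (clamp d t)) -
    (P (f c) 0 - P (f c') 0)); last by rewrite P0 P0' /T; zmod.
  have := @mean_value0 _ _ (fun s => P (f c) s - P (f c') s)
    (fun s => f c s - f c' s) (clamp d t) (L * e).
  move=> /(_ _ _)/le_trans; apply.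
  - by move=> s /le_cl st; apply: is_deriveB; [exact: Pd|exact: Pd'].
  - move=> s _; apply: le_trans (FL _ _ _ _ (gc.2 s) (gc'.2 s)) _.
      exact: clamp_le.
    by rewrite ler_wpM2l.
  rewrite mulrAC -[leRHS]mulrC ler_wpM2r// -[2^-1]mul1r; apply: le_trans Ld.
  by rewrite ler_wpM2l// clamp_le.
pose c k := iter k T (cst x).
have c_good k : good (c k).
  elim: k => [|k IH]; last exact: Tgood.
  by split=> [|s]; [exact: cst_continuous|rewrite /c /= subrr normr0].
have cS k t : `|c k.+1 t - c k t| <= r / 2 ^+ k.
  elim: k t => [|k IH] t; first by rewrite expr0 divr1; exact: (c_good 1%N).2.
  rewrite exprSr invfM mulrA; apply: (Tcontr (c k.+1) (c k)) => //.
(* The rate does not depend on [t]: the convergence is uniform, so the limit inherits continuity. *)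
have [l lP] := choice (fun t => @geometric_limit_rV (fun k => c k t) r (fun k => cS k t)).
have l_good : good l.
  split=> [t|s].
    apply/cvgrPdist_le => e e0; have e4 : 0 < e / 4 by rewrite divr_gt0.
    have [k ke] := near_half_pow (r * 2) e4.
    have /cvgrPdist_le/(_ _ e4) := (c_good k).1 t.
    apply: filterS => s h; rewrite (_ : e = e / 4 + e / 4 + e / 4 + e / 4); last by field.
    apply: (@ler_norm_split _ _ _ (l t - c k s) (c k s - l s)); first by zmod.
      apply: (@ler_norm_split _ _ _ (l t - c k t) (c k t - c k s)); first by zmod.
        by rewrite distrC; have := lP t k; lra.
      by lra.
    by have := lP s k; lra.
  apply/ler_addgt0Pr => e e0; have [k ke] := near_half_pow (r * 2) e0.
  apply: (@ler_norm_split _ _ _ (c k s - x) (- (c k s - l s))); first by zmod.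
    exact: (c_good k).2.
  by rewrite normrN; exact: le_trans (lP s k) ke.
have TlE t : T l t = l t.
  apply/subr0_eq/ler_eps_norm => e e0; have e2 : 0 < e / 2 by rewrite divr_gt0.
  have [k ke] := near_half_pow (r * 2) e2.
  rewrite [leRHS](splitr e).
  apply: (@ler_norm_split _ _ _ (T l t - T (c k) t) (c k.+1 t - l t)).
  - by rewrite /c /=; zmod.
  - apply: le_trans (_ : r * 2 / 2 ^+ k / 2 <= _); last first.
      have : 0 <= r * 2 / 2 ^+ k by rewrite divr_ge0 ?exprn_ge0// mulr_ge0.
      by lra.
    by apply: Tcontr => // s; rewrite distrC.
  - apply: le_trans (lP t k.+1) (le_trans _ ke).
    by rewrite ler_wpM2l ?mulr_ge0// lef_pV2 ?posrE ?exprn_gt0// exprS ler_peMl ?exprn_ge0// ler1n.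
have [P0 Pd] := PE _ (fcont l l_good).
have gE t : `|t| <= d -> x + P (f l) t = l t.
  by move=> td; rewrite -TlE /T clamp_id.
(* This curve agrees with the fixed point [l] on [[- d, d]], and its derivative is known because it
   is a primitive. *)
exists (fun t => x + P (f l) t); split.
- by rewrite P0 addr0.
- by move=> t td; rewrite gE//; exact: l_good.2.
move=> t td; rewrite gE ?ltW// -[F t (l t)]add0r.
apply: is_deriveD; have := Pd t (lt_trans td d1).
by rewrite /f clamp_id// ltW.
Qed.
End Picard.

(** * Chain rule along curves, uniqueness of integral curves, reversal of flows *)

Section IntegralCurves.
Context {R : realType}.

Lemma is_derive1_diff (V : normedModType R) (f : R -> V) t df :
  is_derive t (1 : R) f df -> is_diff t f (fun h => h *: df).
Proof.
move=> [fd <-]; split; first exact/derivable1_diffP.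
by rewrite deriv1E// derive1E.
Qed.

Lemma is_diff_derive1 (V : normedModType R) (f : R -> V) (t : R) df :
  is_diff t f df -> is_derive t (1 : R) f (df 1).
Proof.
move=> [fd dfE]; split; first exact/derivable1_diffP.
by rewrite deriveE// dfE.
Qed.

Lemma is_derive1_comp (V W : normedModType R) (g : R -> V) (f : V -> W) t dg df :
  is_derive t (1 : R) g dg -> is_diff (g t) f df ->
  is_derive t (1 : R) (f \o g) (df dg).
Proof.
move=> /is_derive1_diff hg hf.
have /is_diff_derive1 := is_diff_comp hg hf.
by rewrite /= scale1r.
Qed.

Lemma is_derive1_shift (V : normedModType R) (g : R -> V) (s t : R) dg :
  is_derive (s + t) (1 : R) g dg -> is_derive t (1 : R) (fun r => g (s + r)) dg.
Proof.
move=> /is_derive1_diff hg.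
have h : is_derive t (1 : R) (fun r : R => s + r) 1.
  by rewrite -[X in is_derive _ _ _ X]add0r; apply: is_deriveD.
by have := is_derive1_comp h hg; rewrite scale1r.
Qed.

Lemma is_derive_line (V : normedModType R) (b c : V) (s : R) :
  is_derive s (1 : R) (fun s => b + s *: c) c.
Proof.
have h := is_diff_derive1 (is_diff_scalel s c).
rewrite scale1r in h; rewrite -[X in is_derive _ _ _ X]add0r.
by apply: is_deriveD; exact: h.
Qed.

Context {n : nat} (Z : 'rV[R]_n -> 'rV[R]_n)
  (dZ : 'rV[R]_n -> 'rV[R]_n -> 'rV[R]_n).
Hypothesis hZ : forall z, sdiff Z z (dZ z).

Lemma integral_curve_unique_near (g1 g2 : R -> 'rV[R]_n) (b c s0 : R) :
  b < s0 < c -> g1 s0 = g2 s0 ->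
  (forall s, b < s < c -> is_derive s (1 : R) g1 (Z (g1 s))) ->
  (forall s, b < s < c -> is_derive s (1 : R) g2 (Z (g2 s))) ->
  \forall s \near s0, g1 s = g2 s.
Proof.
move=> /andP[bs0 s0c] g12 h1 h2.
have [L [d [L0 d0 ZL]]] := sdiff_lip (hZ (g1 s0)).
have s0bc : b < s0 < c by rewrite bs0.
have near_ball g : g s0 = g1 s0 -> is_derive s0 (1 : R) g (Z (g s0)) ->
    \forall s \near s0, `|g s - g1 s0| < d.
  move=> gs0 /is_derive1_cont /cvgrPdist_lt/(_ _ d0); rewrite gs0.
  by apply: filterS => s; rewrite distrC.
have /nbhs_normP[r /= r0 rP] : \forall s \near s0,
    [/\ b < s < c, `|g1 s - g1 s0| < d & `|g2 s - g1 s0| < d].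
  near=> s; split; last 2 first.
  - by near: s; apply: near_ball => //; exact: h1.
  - by near: s; apply: near_ball => //; exact: h2.
  - have : s \in `]b, c[ by near: s; apply: near_in_itvoo; rewrite in_itv.
    by rewrite in_itv.
apply/nbhs_normP; exists (Num.min r (1 / 2 / L)) => /=.
  by rewrite lt_min r0 !divr_gt0.
move=> s; rewrite /ball_ /= distrC lt_min => /andP[sr].
rewrite ltr_pdivlMr// mulrC => /ltW sL.
have inr q : `|q| <= `|s - s0| ->
    [/\ b < s0 + q < c, `|g1 (s0 + q) - g1 s0| < d & `|g2 (s0 + q) - g1 s0| < d].
  move=> qs; apply: rP; rewrite /ball_ /= opprD addrA subrr sub0r normrN.
  exact: le_lt_trans sr.
(* Gronwall with [e := 0], applied to a difference that vanishes at [s0]; the radius [1 / 2 / L] is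
   the length that it allows. *)
have := @short_gronwall _ _ (fun q => g1 (s0 + q) - g2 (s0 + q))
  (fun q => Z (g1 (s0 + q)) - Z (g2 (s0 + q))) (s - s0) L 0 (ltW L0) (lexx 0) sL.
rewrite mul0r !addr0 g12 subrr normr0 mulr0 [s0 + _]addrC subrK => H.
apply/eqP; rewrite -subr_eq0 -normr_le0; apply: H => q /inr[bc q1 q2].
  by apply: is_deriveB; apply: is_derive1_shift; [exact: h1|exact: h2].
by rewrite addr0 ZL.
Unshelve. all: by end_near. Qed.

(** In the connected interval [A], the set of agreement [B] is nonempty, open by local uniqueness
    and closed by continuity. *)
Lemma integral_curve_unique (g1 g2 : R -> 'rV[R]_n) (b c t : R) :
  b < 0 < c -> g1 0 = g2 0 ->
  (forall s, b < s < c -> is_derive s (1 : R) g1 (Z (g1 s))) ->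
  (forall s, b < s < c -> is_derive s (1 : R) g2 (Z (g2 s))) ->
  b < t < c -> g1 t = g2 t.
Proof.
move=> bc0 g12 h1 h2 tbc.
pose A := [set s | b < s < c]; pose B := [set s | b < s < c /\ g1 s = g2 s].
have Ac : connected A.
  apply/connected_intervalP => x y /andP[bx xc] /andP[b_y yc] z /andP[xz zy].
  by apply/andP; split; [exact: lt_le_trans xz|exact: le_lt_trans yc].
suff BA : B = A by have : A t by []; rewrite -BA => -[].
apply: Ac; first by exists 0.
- exists [set s | \forall s' \near s, g1 s' = g2 s'].
    by rewrite openE => s; exact: near_join.
  apply/seteqP; split=> [s [sbc e]|s [sbc /nbhs_singleton e]]; last by split.
  by split=> //; exact: integral_curve_unique_near h1 h2.
- exists (closure B); first exact: closed_closure.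
  apply/seteqP; split=> [s Bs|s [sbc cBs]].
    by split; [case: Bs|exact: subset_closure].
  split=> //; apply/subr0_eq/ler_eps_norm => e e0.
  have uc : {for s, continuous (fun r => g1 r - g2 r)}.
    exact: is_derive1_cont (is_deriveB (h1 s sbc) (h2 s sbc)).
  have [r [[_ gr] /=]] := cBs _ ((cvgrPdist_le _ _).1 uc e e0).
  by rewrite gr subrr subr0.
Qed.

Lemma flows_to_unique t x y y' :
  flows_to Z t x y -> flows_to Z t x y' -> y = y'.
Proof.
move=> [b [c [g [/andP[b0 c0] /andP[bt tc] g0 gZ <-]]]].
move=> [b' [c' [g' [/andP[b'0 c'0] /andP[b't tc'] g'0 g'Z <-]]]].
have sub s : Num.max b b' < s < Num.min c c' -> b < s < c /\ b' < s < c'.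
  by rewrite gt_max lt_min => /andP[/andP[-> ->] /andP[-> ->]].
apply: (@integral_curve_unique g g' (Num.max b b') (Num.min c c')).
- by rewrite gt_max lt_min b0 b'0 c0.
- by rewrite g0.
- by move=> s /sub[+ _]; exact: gZ.
- by move=> s /sub[_]; exact: g'Z.
- by rewrite gt_max lt_min bt b't tc.
Qed.

Lemma flowE t x y : flows_to Z t x y -> flow Z t x = y.
Proof.
move=> h; apply: flows_to_unique _ (h).
exact: (@xgetPex _ x [set y | flows_to Z t x y] (ex_intro _ y h)).
Qed.

(** At time [0] any value chosen by [xget] is [x], and so is the default. *)
Lemma flow0 (Y : 'rV[R]_n -> 'rV[R]_n) x : flow Y 0 x = x.
Proof. by rewrite /flow; case: xgetP => // y _ [b [c [g [_ _ -> _ ->]]]]. Qed.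

Lemma flow_definedP t x : flow_defined Z t x <-> flows_to Z t x (flow Z t x).
Proof. by split=> [[y h]|h]; [rewrite (flowE h)|exists (flow Z t x)]. Qed.

Lemma flows_to_rev t x y : flows_to Z t x y -> flows_to Z (- t) y x.
Proof.
move=> [b [c [g [/andP[b0 c0] /andP[bt tc] g0 gZ gt]]]].
exists (b - t), (c - t), (fun s => g (t + s)); split.
- by rewrite subr_lt0 bt subr_gt0.
- by rewrite ltrBlDr addrC subrr b0 ltrBrDr addrC subrr.
- by rewrite addr0.
- move=> s sbc; apply: is_derive1_shift; apply: gZ.
  by move: sbc; rewrite ltrBlDr ltrBrDr addrC.
- by rewrite subrr.
Qed.

Lemma flowK t x : flow_defined Z t x -> flow Z (- t) (flow Z t x) = x.
Proof. by move=> /flow_definedP/flows_to_rev/flowE. Qed.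

End IntegralCurves.

(** * Local flows *)

(** The equation together with its first variation, for a pair stored as one row of length [n + n],
    so that results on flows apply to it unchanged. *)
Definition tangent_field (R : realType) (n : nat) (Z : 'rV[R]_n -> 'rV[R]_n)
    (dZ : 'rV[R]_n -> 'rV[R]_n -> 'rV[R]_n) (z : 'rV[R]_(n + n)) : 'rV[R]_(n + n) :=
  row_mx (Z (lsubmx z)) (dZ (lsubmx z) (rsubmx z)).

Lemma is_derive_row_mx (R : realType) (n1 n2 : nat) (u : R -> 'rV[R]_n1)
    (v : R -> 'rV[R]_n2) (t : R) du dv :
  is_derive t (1 : R) u du -> is_derive t (1 : R) v dv ->
  is_derive t (1 : R) (fun s => row_mx (u s) (v s)) (row_mx du dv).
Proof.
move=> /is_derive_rowP hu /is_derive_rowP hv; apply/is_derive_rowP => i.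
rewrite mxE; under eq_fun do rewrite mxE.
by case: splitP => k _; [exact: hu|exact: hv].
Qed.

Lemma mean_value_around (R : realType) (n : nat) (u du : R -> 'rV[R]_n)
    (t0 r K t1 t2 : R) :
  (forall s, `|s - t0| < r -> is_derive s (1 : R) u (du s)) ->
  (forall s, `|s - t0| < r -> `|du s| <= K) ->
  `|t1 - t0| < r -> `|t2 - t0| < r -> `|u t1 - u t2| <= K * `|t1 - t2|.
Proof.
wlog t21 : t1 t2 / t2 <= t1 => [H ud duK t1r t2r|ud duK].
  have [t21|/ltW t12] := leP t2 t1; first exact: H.
  by rewrite distrC [`|t1 - t2|]distrC; exact: H.
rewrite !ltr_norml => /andP[_ t1r] /andP[t2r _].
have le s : t2 <= s <= t1 -> `|s - t0| < r.
  move=> /andP[ts st]; rewrite ltr_norml; apply/andP; split; lra.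
rewrite [X in _ * X]ger0_norm ?subr_ge0//.
by apply: (@mean_value _ _ u du) => // s /le; [exact: ud|exact: duK].
Qed.

Section LocalFlow.
Context {R : realType} {n : nat} (Z : 'rV[R]_n -> 'rV[R]_n)
  (dZ : 'rV[R]_n -> 'rV[R]_n -> 'rV[R]_n).
Hypothesis hZ : forall z, sdiff Z z (dZ z).

Lemma Z_continuous : continuous Z.
Proof. by move=> z; exact: sdiff_cont (hZ z). Qed.

Lemma flow_box (z0 : 'rV[R]_n) : exists d L M T : R,
  [/\ 0 < d, 0 < L, 0 < T & L * T <= 1 / 2] /\
  [/\ forall a b, `|a - z0| < d -> `|b - z0| < d ->
        `|Z a - Z b| <= L * `|a - b|,
      forall a, `|a - z0| < d -> `|Z a| <= M &
      forall t x, `|t| < T -> `|x - z0| < d / 2 ->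
        [/\ flow_defined Z t x, `|flow Z t x - z0| < d &
            is_derive t (1 : R) (flow Z ^~ x) (Z (flow Z t x))]].
Proof.
have [L [d [L0 d0 ZL]]] := sdiff_lip (hZ z0).
have d2 : 0 < d / 2 by rewrite divr_gt0.
pose M := `|Z z0| + L * d.
have M0 : 0 <= M by rewrite addr_ge0// mulr_ge0// ltW.
have ZM a : `|a - z0| < d -> `|Z a| <= M.
  move=> ad; apply: (@ler_norm_split _ _ _ (Z z0) (Z a - Z z0)) => //; first by zmod.
  apply: le_trans (ZL _ _ ad _) _; first by rewrite subrr normr0.
  by rewrite ler_wpM2l// ltW.
(* The first bound serves contraction and Gronwall; the second keeps a trajectory of speed at most
   [M] within [d / 2] of its start, [M + 1] being surely positive. *)
pose T := Num.min (1 / 2 / L) (d / 2 / (M + 1)).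
have M1 : 0 < M + 1 by rewrite ltr_wpDl.
have T0 : 0 < T by rewrite lt_min !divr_gt0.
have LT : L * T <= 1 / 2 by rewrite mulrC -ler_pdivlMr// ge_min lexx.
have MT : M * T <= d / 2.
  have : T * (M + 1) <= d / 2 by rewrite -ler_pdivlMr// ge_min lexx orbT.
  by apply: le_trans; rewrite mulrC ler_wpM2l ?lerDl ?(ltW T0).
exists d, L, M, T; split=> //; split=> // t0 x t0T xz0.
have inb y : `|y - x| <= d / 2 -> `|y - z0| < d.
  move=> yx; rewrite [ltRHS](splitr d); apply: le_lt_trans (ler_ltD yx xz0).
  by apply: (@ler_norm_split _ _ _ (y - x) (x - z0)) => //; zmod.
have [g [g0 gx gZ]] : exists g : R -> 'rV[R]_n, [/\ g 0 = x,
    forall t, `|t| <= T -> `|g t - x| <= d / 2 &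
    forall t, `|t| < T -> is_derive t (1 : R) g (Z (g t))].
  apply: (@picard _ _ (fun=> Z) x T L (d / 2)) => //; try exact: ltW.
  - by move=> t y z _ /inb yd /inb zd; exact: ZL.
  - by move=> t y _ /inb yd; apply: le_trans MT; rewrite ler_wpM2r ?ZM// ltW.
  - move=> g gc _ s; apply: continuous_comp; [exact: gc|exact: Z_continuous].
have fto t : `|t| < T -> flows_to Z t x (g t).
  move=> tT; exists (- T), T, g; split=> //.
  - by rewrite oppr_lt0 T0.
  - by rewrite -ltr_norml.
  - by move=> s; rewrite -ltr_norml => /gZ.
have fE t : `|t| < T -> flow Z t x = g t by move=> /fto /(flowE hZ).
split; first by exists (g t0); exact: fto.
- by rewrite fE// inb// gx// ltW.
rewrite fE//; apply: near_eq_is_derive (gZ _ t0T).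
apply/nbhs_normP; exists (T - `|t0|); first by rewrite /= subr_gt0.
move=> s; rewrite /ball_ /= ltrBrDr => h; rewrite fE//; apply: le_lt_trans h.
rewrite -[X in _ <= X + _]normrN; apply: (@ler_norm_split R R^o s (- (t0 - s)) t0) => //.
by rewrite opprB subrK.
Qed.

Lemma diff_linear z : linear (dZ z).
Proof. by have [] := hZ z. Qed.

(** Linearity separates the change of base point, controlled by [sdiff_near], from the change of
    vector, controlled by the bound on [dZ a]. *)
Lemma diff_continuous2 (a v : 'rV[R]_n) e : 0 < e ->
  exists2 r, 0 < r & forall a' v', `|a' - a| < r -> `|v' - v| < r ->
    `|dZ a' v' - dZ a v| <= e.
Proof.
move=> e0; have [_ [K [K0 dK]] _] := hZ a.
have e1 : 0 < e / 2 / (`|v| + 1) by rewrite !divr_gt0// ltr_wpDl.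
have /near_norm[r r0 rP] := sdiff_near (hZ a) e1.
exists (Num.min r (Num.min 1 (e / 2 / K))).
  by rewrite !lt_min r0 ltr01 !divr_gt0.
move=> a' v'; rewrite !lt_min => /and3P[a'r _ _] /and3P[_ v1 vK].
rewrite [leRHS](splitr e).
apply: (@ler_norm_split _ _ _ (dZ a' v' - dZ a v') (dZ a (v' - v))).
- by rewrite (linB _ _ (diff_linear a)); zmod.
- apply: (le_trans (rP a' a'r _ (hZ a') v')).
  rewrite -[leRHS](divfK (_ : `|v| + 1 != 0)) ?gt_eqF ?ltr_wpDl//.
  rewrite ler_wpM2l ?(ltW e1)//.
  by apply: (@ler_norm_split _ _ _ v (v' - v)); [zmod| |exact: ltW].
- apply: (le_trans (dK _)); rewrite mulrC -ler_pdivlMr//; exact: ltW.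
Qed.

Lemma diff_comp_continuous (u w : R -> 'rV[R]_n) :
  continuous u -> continuous w -> continuous (fun s => dZ (u s) (w s)).
Proof.
move=> uc wc s; apply/cvgrPdist_le => e e0.
have [r r0 rP] := diff_continuous2 (u s) (w s) e0.
near=> s'; rewrite distrC; apply: rP; rewrite distrC; near: s'.
  by have /cvgrPdist_lt := uc s; apply.
by have /cvgrPdist_lt := wc s; apply.
Unshelve. all: by end_near. Qed.

(* Compactness of the time interval makes the strict differentiability of [Z]
   uniform along a trajectory. *)
Lemma sdiff_uniform_along (u : R -> 'rV[R]_n) (T e : R) : 0 < e ->
  (forall s, `|s| <= T -> {for s, continuous u}) ->
  exists2 r, 0 < r & forall s a b, `|s| <= T -> `|a - u s| < r -> `|b - u s| < r ->
    `|Z a - Z b - dZ (u s) (a - b)| <= e * `|a - b|.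
Proof.
move=> e0 uc.
pose P (r s : R) := forall a b, `|a - u s| < r -> `|b - u s| < r ->
    `|Z a - Z b - dZ (u s) (a - b)| <= e * `|a - b|.
suff /nbhs_ballP[r /= r0 rP] : \forall r \near 0^'+, `[- T, T]%classic `<=` P r.
  exists (r / 2); first by rewrite divr_gt0.
  move=> s a b sT; apply: (rP (r / 2)) => /=.
  - rewrite /ball /= sub0r normrN gtr0_norm ?divr_gt0//; lra.
  - by rewrite divr_gt0.
  - by rewrite in_itv /= -ler_norml.
have /compact_near_coveringP := @segment_compact R (- T) T.
apply=> s /=; rewrite in_itv /= -ler_norml => /uc us.
have e2 : 0 < e / 2 by rewrite divr_gt0.
have [_ _ /(_ _ e2)[d d0 dP]] := hZ (u s).
have /near_norm[d' d'0 d'P] := sdiff_near (hZ (u s)) e2.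
near=> s' r => a b ar br.
have s'd : `|u s' - u s| < Num.min (d / 2) d'.
  rewrite distrC; near: s'; have /cvgrPdist_lt := us; apply.
  by rewrite lt_min divr_gt0.
move: s'd; rewrite lt_min => /andP[s'd s'd'].
have rd : r < d / 2 by near: r; apply: nbhs_right_lt; rewrite divr_gt0.
have aux c : `|c - u s'| < r -> `|c - u s| < d.
  move=> cr; rewrite [ltRHS](splitr d).
  apply: le_lt_trans (ltrD (lt_trans cr rd) s'd).
  by apply: (@ler_norm_split _ _ _ (c - u s') (u s' - u s)) => //; zmod.
rewrite (splitr e) mulrDl.
have := d'P _ s'd' _ (hZ (u s')) (a - b); rewrite distrC => h'.
by apply: ler_norm_split (dP _ _ (aux a ar) (aux b br)) h'; zmod.
Unshelve. all: by end_near. Qed.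

(** [W h] is the value at time [t] of the solution of the variational equation issued from [h];
    recording it as a trajectory of the tangent field is what later identifies it with a flow. The
    strict remainder splits into a time increment at a fixed initial point, an increment of the
    initial point at a fixed time, and the change of [W] with time, each within a third of [e]. *)
Lemma flow_local (z0 : 'rV[R]_n) : exists2 r, 0 < r & forall t x,
  `|t| < r -> `|x - z0| < r -> flow_defined Z t x /\
  exists W, sdiff (fun q : R * 'rV[R]_n => flow Z q.1 q.2) (t, x)
      (fun q => q.1 *: Z (flow Z t x) + W q.2) /\
    forall h, flows_to (tangent_field Z dZ) t (row_mx x h)
      (row_mx (flow Z t x) (W h)).
Proof.
have [d [L [M [T [[d0 L0 T0 LT] [ZL ZM flowP]]]]]] := flow_box z0.
have d20 : 0 < d / 2 by rewrite divr_gt0.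
have d2d : d / 2 < d by lra.
have M0 : 0 <= M by apply: le_trans (ZM z0 _); rewrite ?normr_ge0// subrr normr0.
(* Halving [T] leaves room for closed intervals of times and gives [L * U <= 1 / 4]. *)
pose U := T / 2; have U0 : 0 < U by rewrite divr_gt0.
have UT : U < T by rewrite /U; lra.
have LU : L * U <= 1 / 4 by rewrite /U mulrA; lra.
have LU2 (t : R) : `|t| < U -> L * `|t| <= 1 / 2.
  by move=> tU; apply: le_trans LT; rewrite ler_wpM2l// ltW// (lt_trans tU).
have dZL a : `|a - z0| < d -> forall v, `|dZ a v| <= L * `|v|.
  move=> ad; apply: (sdiff_le (d := d - `|a - z0|) (hZ a)); last by rewrite subr_gt0.
  have aux c : `|c - a| < d - `|a - z0| -> `|c - z0| < d.
    rewrite ltrBrDr; apply: le_lt_trans.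
    by apply: (@ler_norm_split _ _ _ (c - a) (a - z0)) => //; zmod.
  by move=> b c /aux bd /aux cd; exact: ZL.
exists (Num.min U (d / 2)); first by rewrite lt_min U0.
move=> t0 x; rewrite !lt_min => /andP[t0U _] /andP[_ xd].
have flT t y : `|t| < U -> `|y - z0| < d / 2 -> [/\ flow_defined Z t y,
    `|flow Z t y - z0| < d & is_derive t (1 : R) (flow Z ^~ y) (Z (flow Z t y))].
  by move=> tU yd; apply: flowP => //; exact: lt_trans UT.
split; first by have [] := flT t0 x t0U xd.
have flow_lip (t : R) y y' : `|t| < U -> `|y - z0| < d / 2 -> `|y' - z0| < d / 2 ->
    `|flow Z t y - flow Z t y'| <= 2 * `|y - y'|.
  move=> tU yd y'd.
  have := @short_gronwall _ _ (fun s => flow Z s y - flow Z s y')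
    (fun s => Z (flow Z s y) - Z (flow Z s y')) t L 0 (ltW L0) (lexx 0) (LU2 t tU).
  rewrite !flow0 mul0r addr0; apply=> s st; have sU := le_lt_trans st tU.
    by apply: is_deriveB; [have [] := flT s y sU yd|have [] := flT s y' sU y'd].
  by rewrite addr0; apply: ZL; [have [] := flT s y sU yd|have [] := flT s y' sU y'd].
have flow_cont : forall s : R, `|s| <= U -> {for s, continuous (flow Z ^~ x)}.
  move=> s sU; have [_ _] := flowP s x (le_lt_trans sU UT) xd.
  exact: is_derive1_cont.
(* The variational equation along the trajectory of [x]. Picard applies in the ball centred at [v]
   whose radius is the norm of [v]: as [L * U <= 1 / 4], the displacement is at most half that
   norm. *)
have Wex v : exists w : R -> 'rV[R]_n, w 0 = v /\ forall t, `|t| < U ->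
    is_derive t (1 : R) w (dZ (flow Z t x) (w t)).
  have inb (t : R) : `|t| <= U -> `|flow Z t x - z0| < d.
    by move=> tU; have [] := flowP t x (le_lt_trans tU UT) xd.
  have [||||g [g0 _ gd]] := @picard _ _ (fun t => dZ (flow Z t x)) v U L `|v|
    U0 (normr_ge0 v) (ltW L0).
  - by apply: le_trans LU _; lra.
  - move=> t y z tU _ _; rewrite -(linB _ _ (diff_linear (flow Z t x))).
    exact/dZL/inb.
  - move=> t y tU yv; apply: le_trans (_ : L * (`|v| + `|v|) * U <= _).
      rewrite ler_wpM2r ?(ltW U0)//; apply: le_trans (dZL _ (inb t tU) _) _.
      rewrite ler_wpM2l ?(ltW L0)//.
      by apply: (@ler_norm_split _ _ _ v (y - v)) => //; zmod.
    rewrite mulrAC; have := normr_ge0 v; have := LU; move: (L * U) (`|v|) => p q.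
    by move=> p4 q0; have := ler_wpM2r q0 p4; lra.
  - move=> g gc _; apply: diff_comp_continuous => // s.
    apply: (@continuous_comp _ _ _ (clamp U) (flow Z ^~ x)).
      exact/clamp_continuous/ltW.
    exact/flow_cont/clamp_le/ltW.
  by exists g.
have [w wP] := choice Wex.
have inb (t : R) : `|t| < U -> `|flow Z t x - z0| < d.
  by move=> tU; have [] := flT t x tU xd.
have w_le v (t : R) : `|t| < U -> `|w v t| <= 2 * `|v|.
  move=> tU; have := @short_gronwall _ _ (w v)
    (fun s => dZ (flow Z s x) (w v s)) t L 0 (ltW L0) (lexx 0) (LU2 t tU).
  rewrite (wP v).1 mul0r addr0; apply=> s st; have sU := le_lt_trans st tU.
    exact: (wP v).2.
  by rewrite addr0; exact/dZL/inb.
(* Linearity in the initial vector is a form of uniqueness: the defect solves the same linear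
   equation and starts at [0], so Gronwall annihilates it. *)
have w_lin (t : R) : `|t| < U -> linear (w ^~ t).
  move=> tU a u v; apply/eqP; rewrite -subr_eq0 -normr_le0.
  have := @short_gronwall _ _ (fun s => w (a *: u + v) s - (a *: w u s + w v s))
    (fun s => dZ (flow Z s x) (w (a *: u + v) s) -
       (a *: dZ (flow Z s x) (w u s) + dZ (flow Z s x) (w v s)))
    t L 0 (ltW L0) (lexx 0) (LU2 t tU).
  rewrite !(wP _).1 subrr normr0 mul0r addr0 mulr0; apply=> s st.
    have sU := le_lt_trans st tU.
    apply: is_deriveB; first exact: (wP _).2.
    by apply: is_deriveD; [apply: is_deriveZ|]; exact: (wP _).2.
  have dl := diff_linear (flow Z s x).
  rewrite addr0 -(linZ _ _ dl) -(linD _ _ dl) -(linB _ _ dl).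
  exact/dZL/inb/(le_lt_trans st).
exists (w ^~ t0); split; last first.
  move=> h; exists (- U), U, (fun s => row_mx (flow Z s x) (w h s)); split.
  - by rewrite oppr_lt0 U0.
  - by rewrite -ltr_norml.
  - by rewrite flow0 (wP h).1.
  - move=> s; rewrite -ltr_norml => sU.
    rewrite /tangent_field row_mxKl row_mxKr; apply: is_derive_row_mx.
      by have [] := flT s x sU xd.
    exact: (wP h).2.
  - by [].
set p := flow Z t0 x.
split.
- by move=> a u v /=; rewrite (w_lin t0 t0U) scalerDl !scalerDr !scalerA; zmod.
- exists (M + 2); split=> [|v]; first by rewrite ltr_wpDl.
  rewrite mulrDl; apply: ler_norm_split => //.
    rewrite normrZ mulrC ler_pM// ?ZM ?inb//.
    by rewrite prod_normE le_max lexx.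
  apply: le_trans (w_le _ _ t0U) _; rewrite ler_wpM2l//.
  by rewrite prod_normE le_max lexx orbT.
move=> e e0; have e3 : 0 < e / 3 by rewrite divr_gt0.
have U1 : 0 < 4 * (U + 1) by rewrite mulr_gt0// addr_gt0.
(* The factor 4 is the Lipschitz constant 2 of the flow in its initial point times the constant 2 of
   [short_gronwall]; elapsed times are below [U + 1]. *)
have [r r0 rP] := sdiff_uniform_along (divr_gt0 e3 U1) flow_cont.
have LM : 0 < L * (M + 3) by rewrite mulr_gt0// ltr_wpDl.
(* The first entry is for [term1], where the speed differs from [Z p] by at most [L * (2 + M)] times
   the radius; the second is for [term3], where [w h] has speed at most [L * 2] times the norm of
   [h]. *)
pose rho1 := Num.min (e / 3 / (L * (M + 3))) (e / 3 / (L * 2)).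
(* [r / 2] compensates the Lipschitz constant 2 of the flow; the last two entries keep initial
   points and times in range. *)
pose rho := Num.min rho1 (Num.min (r / 2) (Num.min (d / 2 - `|x - z0|) (U - `|t0|))).
exists rho; first by rewrite !lt_min !divr_gt0 ?subr_gt0 ?xd ?t0U ?mulr_gt0 ?ltr_wpDl.
have [l1 l2 l3 l4] : [/\ rho <= rho1, rho <= r / 2, rho <= d / 2 - `|x - z0|
    & rho <= U - `|t0|].
  clearbody rho1; split; rewrite /rho !ge_min ?lexx ?orbT//.
have around (s : R) : `|s - t0| < U - `|t0| -> `|s| < U.
  rewrite ltrBrDr; apply: le_lt_trans.
  by apply: (@ler_norm_split R R^o _ (s - t0) t0) => //; rewrite subrK.
have rhoP (q : R * 'rV[R]_n) : `|q - (t0, x)| < rho ->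
    [/\ `|q.1 - t0| < rho1 /\ `|q.1 - t0| < U - `|t0|, `|q.1| < U,
      `|q.2 - x| < rho1, `|q.2 - x| < r / 2 & `|q.2 - z0| < d / 2].
  rewrite prod_normE gt_max /= => /andP[p1 p2].
  have q1 := lt_le_trans p1 l4; have q2 := lt_le_trans p2 l3.
  split.
  - by split=> //; exact: lt_le_trans l1.
  - exact: around.
  - exact: lt_le_trans l1.
  - exact: lt_le_trans l2.
  move: q2; rewrite ltrBrDr; apply: le_lt_trans.
  by apply: (@ler_norm_split _ _ _ (q.2 - x) (x - z0)) => //; zmod.
move=> q1 q2 /rhoP[[a1 h1] b1 c1 f1 g1] /rhoP[[a2 h2] b2 c2 f2 g2].
set N := `|q1 - q2|; set h := q1.2 - q2.2.
have hN : `|h| <= N by rewrite /N prod_normE le_max lexx orbT.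
have tN : `|q1.1 - q2.1| <= N by rewrite /N prod_normE le_max lexx.
have term1 : `|(flow Z q1.1 q1.2 - q1.1 *: Z p) - (flow Z q2.1 q1.2 - q2.1 *: Z p)|
    <= e / 3 * `|q1.1 - q2.1|.
  move: a1 a2; rewrite !lt_min => /andP[a1 _] /andP[a2 _].
  pose rr := Num.min (e / 3 / (L * (M + 3))) (U - `|t0|).
  have rrU (s : R) : `|s - t0| < rr -> `|s| < U.
    by rewrite lt_min => /andP[_ /around].
  apply: (@mean_value_around _ _ (fun s => flow Z s q1.2 - s *: Z p)
    (fun s => Z (flow Z s q1.2) - Z p) t0 rr); last 2 first.
  - by rewrite lt_min a1 h1.
  - by rewrite lt_min a2 h2.
  - move=> s /rrU sU; apply: is_deriveB; first by have [] := flT s q1.2 sU g1.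
    by have := @is_diff_derive1 _ _ (fun s : R => s *: Z p) s _ (is_diff_scalel s (Z p));
       rewrite /= scale1r.
  move=> s sr'; have sU := rrU s sr'; move: (sr'); rewrite lt_min => /andP[/ltW sr _].
  have [_ fd _] := flT s q1.2 sU g1.
  apply: (le_trans (ZL _ _ fd (inb t0 t0U))).
  rewrite mulrC -ler_pdivlMr//.
  apply: le_trans (_ : 2 * (e / 3 / (L * (M + 3))) + M * (e / 3 / (L * (M + 3))) <= _).
    apply: (@ler_norm_split _ _ _ (flow Z s q1.2 - flow Z s x) (flow Z s x - p)).
    - by zmod.
    - apply: le_trans (flow_lip _ _ _ sU g1 xd) _; rewrite ler_wpM2l//.
      by move: c1; rewrite lt_min => /andP[/ltW].
    - apply: (@le_trans _ _ (M * `|s - t0|)); last by rewrite ler_wpM2l.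
      apply: (@mean_value_around _ _ (flow Z ^~ x) (fun s => Z (flow Z s x)) t0
        (U - `|t0|)).
      + by move=> s' /around/(flT _ x)/(_ xd)[].
      + by move=> s' /around /inb; exact: ZM.
      + by move: sr'; rewrite lt_min => /andP[_].
      + by rewrite subrr normr0 subr_gt0.
  rewrite (_ : _ + _ = e / 3 / L * ((2 + M) / (M + 3))); last first.
    by field; rewrite !gt_eqF// ltr_wpDl.
  rewrite -[leRHS]mulr1; apply: ler_wpM2l; first by rewrite ltW// divr_gt0.
  have M3 : 0 < M + 3 by rewrite ltr_wpDl.
  by rewrite ler_pdivrMr// mul1r addrC lerD2l ler_nat.
(* Gronwall for the increment of the flow minus [w h]: the forcing term is the strict remainder of
   [Z], small uniformly along the trajectory of [x]. *)
have term2 : `|flow Z q2.1 q1.2 - flow Z q2.1 q2.2 - w h q2.1| <= e / 3 * `|h|.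
  have := @short_gronwall _ _ (fun s => flow Z s q1.2 - flow Z s q2.2 - w h s)
    (fun s => Z (flow Z s q1.2) - Z (flow Z s q2.2) - dZ (flow Z s x) (w h s))
    q2.1 L (e / 3 / (4 * (U + 1)) * (2 * `|h|)) (ltW L0) _ (LU2 _ b2).
  rewrite !flow0 (wP h).1 subrr normr0 add0r => H.
  apply: le_trans (H _ _ _) _.
  - by apply: mulr_ge0; [exact/ltW/divr_gt0|exact: mulr_ge0].
  - move=> s sq; have sU := le_lt_trans sq b2.
    apply: is_deriveB; last exact: (wP h).2.
    by apply: is_deriveB; [have [] := flT s q1.2 sU g1|have [] := flT s q2.2 sU g2].
  - move=> s sq; have sU := le_lt_trans sq b2; rewrite [leRHS]addrC.
    apply: (@ler_norm_split _ _ _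
      (Z (flow Z s q1.2) - Z (flow Z s q2.2) - dZ (flow Z s x) (flow Z s q1.2 - flow Z s q2.2))
      (dZ (flow Z s x) (flow Z s q1.2 - flow Z s q2.2 - w h s))).
    + by rewrite [in RHS](linB _ (w h s) (diff_linear _)); zmod.
    + have rr y : `|y - z0| < d / 2 -> `|y - x| < r / 2 -> `|flow Z s y - flow Z s x| < r.
        move=> yd yr; apply: le_lt_trans (flow_lip _ _ _ sU yd xd) _.
        by rewrite mulrC -ltr_pdivlMr.
      apply: le_trans (rP s _ _ (ltW sU) (rr _ g1 f1) (rr _ g2 f2)) _.
      apply: ler_wpM2l; first exact/ltW/divr_gt0.
      exact: flow_lip.
    + exact/dZL/inb.
  have h0 : 0 <= `|h| by [].
  rewrite (_ : 2 * _ = (e / 3 * `|h|) * (`|q2.1| / (U + 1))); last first.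
    by field; rewrite gt_eqF// addr_gt0.
  rewrite -[leRHS]mulr1; apply: ler_wpM2l; first by rewrite mulr_ge0// ltW.
  rewrite ler_pdivrMr ?addr_gt0// mul1r (le_trans (ltW b2))// lerDl//.
have term3 : `|w h q2.1 - w h t0| <= e / 3 * `|h|.
  move: a2; rewrite !lt_min => /andP[_ a2].
  have K : L * (2 * `|h|) * `|q2.1 - t0| <= e / 3 * `|h|.
    rewrite (_ : _ * _ * _ = (`|q2.1 - t0| * (L * 2)) * `|h|); last by ring.
    by rewrite ler_wpM2r// -ler_pdivlMr ?mulr_gt0// ltW.
  apply: le_trans K; apply: (@mean_value_around _ _ (w h)
    (fun s => dZ (flow Z s x) (w h s)) t0 (U - `|t0|)).
  - move=> s /around sU; exact: (wP h).2.
  - move=> s /around sU; apply: le_trans (dZL _ (inb s sU) _) _.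
    by rewrite ler_wpM2l ?(ltW L0)// w_le.
  - exact: h2.
  - by rewrite subrr normr0 subr_gt0.
rewrite (_ : e * N = e / 3 * N + (e / 3 * N + e / 3 * N)); last by field.
apply: ler_norm_split (le_trans term1 _)
  (ler_norm_split erefl (le_trans term2 _) (le_trans term3 _));
  rewrite ?ler_wpM2l ?(ltW e3)//=.
rewrite scalerBl; zmod.
Qed.

End LocalFlow.

(** * Strict differentiability of C^1 maps and the Schwarz theorem *)

Section RowMaps.
Context {R : realType}.

Lemma lsubmx_norm_le n1 n2 (v : 'rV[R]_(n1 + n2)) : `|lsubmx v| <= `|v|.
Proof. by apply: rV_norm_le => // i; rewrite mxE; exact: coord_norm_le. Qed.

Lemma rsubmx_norm_le n1 n2 (v : 'rV[R]_(n1 + n2)) : `|rsubmx v| <= `|v|.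
Proof. by apply: rV_norm_le => // i; rewrite mxE; exact: coord_norm_le. Qed.

Lemma lsubmx_linear n1 n2 : linear (@lsubmx R 1 n1 n2).
Proof. by move=> a u v; apply/rowP => i; rewrite !mxE. Qed.

Lemma rsubmx_linear n1 n2 : linear (@rsubmx R 1 n1 n2).
Proof. by move=> a u v; apply/rowP => i; rewrite !mxE. Qed.

Lemma coord_linear n (i : 'I_n) : linear (fun v : 'rV[R]_n => v 0 i : R).
Proof. by move=> a u v; rewrite !mxE. Qed.

Lemma sdiff_coord n (i : 'I_n) (z : 'rV[R]_n) :
  sdiff (fun v : 'rV[R]_n => v 0 i : R) z (fun v => v 0 i).
Proof.
apply: (@sdiff_lin _ _ _ _ 1); first exact: coord_linear.
by move=> v; rewrite mul1r; exact: coord_norm_le.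
Qed.

Lemma sdiff_lsubmx n1 n2 (z : 'rV[R]_(n1 + n2)) : sdiff lsubmx z lsubmx.
Proof.
apply: (@sdiff_lin _ _ _ _ 1); first exact: lsubmx_linear.
by move=> v; rewrite mul1r lsubmx_norm_le.
Qed.

Lemma sdiff_rsubmx n1 n2 (z : 'rV[R]_(n1 + n2)) : sdiff rsubmx z rsubmx.
Proof.
apply: (@sdiff_lin _ _ _ _ 1); first exact: rsubmx_linear.
by move=> v; rewrite mul1r rsubmx_norm_le.
Qed.

Lemma sdiff_row_mx (E : normedModType R) n1 n2 (f : E -> 'rV[R]_n1)
    (g : E -> 'rV[R]_n2) z df dg :
  sdiff f z df -> sdiff g z dg ->
  sdiff (fun x => row_mx (f x) (g x)) z (fun v => row_mx (df v) (dg v)).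
Proof.
move=> hf hg.
apply: (@sdiff_comp _ _ _ _ _ (fun q => row_mx q.1 q.2) z _
  (fun q => row_mx q.1 q.2) (sdiff_pair hf hg)).
apply: (@sdiff_lin _ _ _ _ 1) => [a u v|v].
  by rewrite -add_row_mx scale_row_mx.
rewrite mul1r; apply: rV_norm_le => // i; rewrite mxE prod_normE le_max.
by case: splitP => k _; rewrite coord_norm_le ?orbT.
Qed.

(** The differential written with partial derivatives: this form exhibits the vector part of
    [tangent_field] as a sum of products of coordinates and partial derivatives of the field. *)
Definition coord_diff n k (f : 'rV[R]_n -> 'rV[R]_k) (z v : 'rV[R]_n) : 'rV[R]_k :=
  \sum_(i < n) v 0 i *: 'D_(delta_mx 0 i) f z.

Lemma diff_coordE n k (f : 'rV[R]_n -> 'rV[R]_k) z v :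
  differentiable f z -> 'd f z v = coord_diff f z v.
Proof.
move=> fd; rewrite {1}(row_sum_delta v) linear_sum; apply: eq_bigr => i _.
by rewrite linearZ/= -deriveE.
Qed.

(** The mean value inequality on the segment from [b] to [a], which stays in the ball around [z],
    turns closeness of the [n] partial derivatives into the strict estimate. *)
Lemma is_Ck1_sdiff n k (f : 'rV[R]_n -> 'rV[R]_k) : is_Ck 1 setT f ->
  forall z, sdiff f z (coord_diff f z).
Proof.
move=> [fd fc] z; split.
- by move=> a u v; rewrite -!diff_coordE; [rewrite linearP|exact: fd..].
- exists (\sum_(i < n) `|'D_(delta_mx 0 i) f z| + 1); split.
    by rewrite ltr_wpDl// sumr_ge0.
  move=> v; rewrite mulrDl mul1r; apply: (@le_trans _ _
    ((\sum_(i < n) `|'D_(delta_mx 0 i) f z|) * `|v|)); last by rewrite lerDl.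
  rewrite mulr_suml; apply: (le_trans (ler_norm_sum _ _ _)); apply: ler_sum => i _.
  by rewrite normrZ mulrC ler_wpM2l// coord_norm_le.
move=> e e0; have e1 : 0 < e / (n%:R + 1) by rewrite divr_gt0// ltr_wpDl.
have /near_norm[d d0 dP] : \forall y \near z, forall i,
    `|'D_(delta_mx 0 i) f y - 'D_(delta_mx 0 i) f z| <= e / (n%:R + 1).
  apply: (@filter_forall _ 'I_n (fun i y =>
    `|'D_(delta_mx 0 i) f y - 'D_(delta_mx 0 i) f z| <= e / (n%:R + 1))
    (nbhs z) (nbhs_filter z)) => i.
  exact: near_dist_le (fc (delta_mx 0 i) z I) e1.
exists d => // a b ad bd.
have ball_conv s : 0 <= s <= 1 -> `|b + s *: (a - b) - z| < d.
  move=> /andP[s0 s1].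
  have -> : b + s *: (a - b) - z = (1 - s) *: (b - z) + s *: (a - z).
    by rewrite scalerBl scale1r !scalerBr; zmod.
  apply: le_lt_trans (ler_normD _ _) _; rewrite !normrZ !ger0_norm ?subr_ge0//.
  have : (1 - s) * `|b - z| <= (1 - s) * Num.max `|a - z| `|b - z|.
    by rewrite ler_wpM2l ?subr_ge0// le_max lexx orbT.
  have : s * `|a - z| <= s * Num.max `|a - z| `|b - z|.
    by rewrite ler_wpM2l// le_max lexx.
  have : Num.max `|a - z| `|b - z| < d by rewrite gt_max ad.
  by rewrite mulrBl mul1r; set q := Num.max _ _; lra.
have := @mean_value _ _ (fun s => f (b + s *: (a - b)) - s *: coord_diff f z (a - b))
  (fun s => coord_diff f (b + s *: (a - b)) (a - b) - coord_diff f z (a - b)) 0 1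
  (e * `|a - b|) ler01.
rewrite !scale1r !scale0r addr0 subr0 [b + _]addrC subrK subr0 mulr1 => H.
rewrite addrAC; apply: H => s s01.
  apply: is_deriveB; last first.
    by have := is_derive_line (0 : 'rV[R]_k) (coord_diff f z (a - b)) s;
       under eq_fun do rewrite add0r.
  rewrite -diff_coordE; last exact: fd.
  exact: is_derive1_comp (is_derive_line b (a - b) s) (differentiableP (fd _ I)).
rewrite /coord_diff -sumrB; apply: (le_trans (ler_norm_sum _ _ _)).
apply: (@le_trans _ _ (\sum_(i < n) e / (n%:R + 1) * `|a - b|)).
  apply: ler_sum => i _; rewrite -scalerBr normrZ mulrC.
  by apply: ler_pM => //; [exact/dP/ball_conv|exact: coord_norm_le].
rewrite sumr_const card_ord -[X in X <= _]mulr_natl mulrA ler_wpM2r// mulrC.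
by rewrite mulrAC ler_pdivrMr ?ltr_wpDl// ler_wpM2l ?(ltW e0)// lerDl.
Qed.

(** The second derivatives of [Y] enter here, as derivatives of the coefficients of
    [coord_diff Y]. *)
Lemma tangent_field_sdiff n (Y : 'rV[R]_n -> 'rV[R]_n) : is_Ck 2 setT Y ->
  forall z, exists A, sdiff (tangent_field Y (coord_diff Y)) z A.
Proof.
move=> [Yd YC] z.
have hY : sdiff Y (lsubmx z) (coord_diff Y (lsubmx z)).
  by apply: is_Ck1_sdiff; split=> // v; have [] := YC v; move=> dv _ y _;
     exact/differentiable_continuous/dv.
have hD i := is_Ck1_sdiff (YC (delta_mx 0 i)) (lsubmx z).
have hl := sdiff_lsubmx z; have hr := sdiff_rsubmx z.
eexists; apply: (sdiff_row_mx (sdiff_comp hl hY)).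
apply: sdiff_sum => i.
exact: (sdiff_scale (sdiff_comp hr (sdiff_coord i _)) (sdiff_comp hl (hD i))).
Qed.

(** Here [fv] is the derivative of [f] along [v]. The second difference of [f] is the increment over
    [[0, h]] of a function of [s] with derivative [fv (p + h *: w + s *: v) - fv (p + s *: v)], and
    strict differentiability of [fv] at [p] makes the latter close to [h *: Dv w]. *)
Lemma schwarz_half (E : normedModType R) k (f : E -> 'rV[R]_k) p v w fv
    (Dv : E -> 'rV[R]_k) e :
  0 < e -> sdiff fv p Dv ->
  (\forall q \near p, exists A, sdiff f q A /\ A v = fv q) ->
  exists2 r, 0 < r & forall h, 0 < h < r ->
    `|f (p + h *: v + h *: w) - f (p + h *: v) - f (p + h *: w) + f p
      - h ^+ 2 *: Dv w| <= e * h ^+ 2 * `|w|.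
Proof.
move=> e0 [Dl _ /(_ e e0)[d d0 dP]] /near_norm[d' d'0 d'P].
have vw : 0 < `|v| + `|w| + 1 by rewrite ltr_wpDl// addr_ge0.
exists (Num.min d d' / (`|v| + `|w| + 1)); first by rewrite divr_gt0// lt_min d0.
move=> h /andP[h0]; rewrite ltr_pdivlMr// => hd.
have inb s c : 0 <= s <= h -> c = 0 \/ c = h ->
    `|p + c *: w + s *: v - p| < Num.min d d'.
  move=> /andP[s0 sh] ch; apply: le_lt_trans hd.
  rewrite (_ : _ - p = c *: w + s *: v); last by zmod.
  apply: (le_trans (ler_normD _ _)); rewrite !normrZ (ger0_norm s0).
  have ch1 : `|c| <= h by case: ch => ->; rewrite ?normr0 ?gtr0_norm// ltW.
  have := ler_wpM2r (normr_ge0 w) ch1; have := ler_wpM2r (normr_ge0 v) sh; lra.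
have fE s c : 0 <= s <= h -> c = 0 \/ c = h ->
    is_derive s (1 : R) (fun s => f (p + c *: w + s *: v)) (fv (p + c *: w + s *: v)).
  move=> sh ch; have := inb s c sh ch; rewrite lt_min => /andP[_ /d'P[A [fA <-]]].
  exact: is_derive1_comp (is_derive_line _ v s) (sdiff_is_diff fA).
have := @mean_value _ _
  (fun s => f (p + h *: w + s *: v) - f (p + 0 *: w + s *: v) - s *: (h *: Dv w))
  (fun s => fv (p + h *: w + s *: v) - fv (p + 0 *: w + s *: v) - h *: Dv w) 0 h
  (e * (h * `|w|)) (ltW h0).
rewrite !scale0r !addr0 !subr0 => H.
rewrite (_ : e * _ * _ = e * (h * `|w|) * h); last by ring.
apply: le_trans (H _ _).
- apply: eq_ler_norm; rewrite scalerA -expr2 (_ : p + h *: v + h *: w = p + h *: w + h *: v).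
    by zmod.
  by zmod.
- move=> s sh; apply: is_deriveB; last first.
    by have := is_derive_line (0 : 'rV[R]_k) (h *: Dv w) s;
       under eq_fun do rewrite add0r.
  apply: is_deriveB; first by apply: fE => //; right.
  by have := fE s 0 sh (or_introl erefl); rewrite scale0r addr0.
- move=> s sh; rewrite -(linZ _ _ Dl).
  have := inb s h sh (or_intror erefl); rewrite lt_min => /andP[h1 _].
  have := inb s 0 sh (or_introl erefl); rewrite lt_min scale0r addr0 => /andP[h2 _].
  have := dP _ _ h1 h2.
  rewrite (_ : p + h *: w + s *: v - (p + s *: v) = h *: w); last by zmod.
  by rewrite normrZ (gtr0_norm h0).
Qed.

(** The second difference is symmetric in [v] and [w], and [schwarz_half] compares it with both
    [h ^+ 2 *: Dv w] and [h ^+ 2 *: Dw v]. *)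
Lemma schwarz (E : normedModType R) k (f : E -> 'rV[R]_k) p v w fv fw Dv Dw :
  sdiff fv p Dv -> sdiff fw p Dw ->
  (\forall q \near p, exists A, [/\ sdiff f q A, A v = fv q & A w = fw q]) ->
  Dv w = Dw v.
Proof.
move=> hv hw hf; apply/subr0_eq/ler_eps_norm => e e0.
have vw : 0 < `|v| + `|w| + 1 by rewrite ltr_wpDl// addr_ge0.
have e1 : 0 < e / (`|v| + `|w| + 1) by rewrite divr_gt0.
have [r r0 rP] := schwarz_half w e1 hv
  (filterS (fun q '(ex_intro A (And3 a b _)) => ex_intro _ A (conj a b)) hf).
have [r' r'0 r'P] := schwarz_half v e1 hw
  (filterS (fun q '(ex_intro A (And3 a _ b)) => ex_intro _ A (conj a b)) hf).
pose h := Num.min r r' / 2.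
have m0 : 0 < Num.min r r' by rewrite lt_min r0.
have h0 : 0 < h by rewrite divr_gt0.
have : h < Num.min r r' by rewrite /h; lra.
rewrite lt_min => /andP[hr hr'].
have /rP h1 : 0 < h < r by rewrite h0. have /r'P h2 : 0 < h < r' by rewrite h0.
have hh : 0 < h ^+ 2 by rewrite exprn_gt0.
rewrite -(ler_pM2l hh) -{1}(gtr0_norm hh) -normrZ.
rewrite -normrN in h1.
apply: le_trans (ler_norm_split _ h1 h2) _.
  by rewrite (_ : p + h *: w + h *: v = p + h *: v + h *: w) ?scalerBr; zmod.
rewrite (_ : _ + _ = h ^+ 2 * (e * ((`|w| + `|v|) / (`|v| + `|w| + 1)))); last first.
  by field; rewrite gt_eqF.
rewrite ler_pM2l// -[leRHS]mulr1 ler_pM2l// ler_pdivrMr// mul1r addrC lerDl//.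
Qed.

End RowMaps.

(** * Compositions of flows *)

Section FlowC1.
Context {R : realType} {n : nat} (Z : 'rV[R]_n -> 'rV[R]_n)
  (dZ : 'rV[R]_n -> 'rV[R]_n -> 'rV[R]_n).
Hypothesis hZ : forall z, sdiff Z z (dZ z).

Lemma near_flow (z0 : 'rV[R]_n) : \forall q \near ((0, z0) : R * 'rV[R]_n),
  flow_defined Z q.1 q.2 /\
  exists W, sdiff (fun q : R * 'rV[R]_n => flow Z q.1 q.2) q
      (fun v => v.1 *: Z (flow Z q.1 q.2) + W v.2) /\
    forall h, flows_to (tangent_field Z dZ) q.1 (row_mx q.2 h)
      (row_mx (flow Z q.1 q.2) (W h)).
Proof.
have [r r0 rP] := flow_local hZ z0; apply/near_norm; exists r => // -[t x].
by rewrite prod_normE gt_max /= subr0 => /andP[]; exact: rP.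
Qed.

Lemma flow_C1at (z0 : 'rV[R]_n) :
  C1at (fun q : R * 'rV[R]_n => flow Z q.1 q.2) (0, z0).
Proof. by apply: filterS (near_flow z0) => q [_ [W [h _]]]; eexists; exact: h. Qed.

End FlowC1.

Section Composition.
Context {R : realType} {m n : nat} (Y : 'I_m -> 'rV[R]_n -> 'rV[R]_n)
  (dY : 'I_m -> 'rV[R]_n -> 'rV[R]_n -> 'rV[R]_n)
  (dT : 'I_m -> 'rV[R]_(n + n) -> 'rV[R]_(n + n) -> 'rV[R]_(n + n)).
Let T j := tangent_field (Y j) (dY j).
Hypothesis hY : forall j z, sdiff (Y j) z (dY j z).
Hypothesis hT : forall j z, sdiff (T j) z (dT j z).

Local Notation PX := ('rV[R]_m * 'rV[R]_n)%type.
Implicit Types (s : seq 'I_m) (q : PX) (x : 'rV[R]_n).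

(** A [foldl], against the [foldr] of [flow_comp]: the head of [s] is the outermost flow and has to
    be undone first. *)
Definition flow_comp_inv s q : 'rV[R]_n :=
  foldl (fun y i => flow (Y i) (- q.1 0 i) y) q.2 s.

(* [push_fields s Z (p, y)] is the value at [y] of the push-forward of the
   field [Z] by [flow_comp Y s p]; the tangent map of each flow is the flow of
   its tangent field. *)
Fixpoint push_fields s (Z : 'rV[R]_n -> 'rV[R]_n) q : 'rV[R]_n :=
  if s is i :: s' then
    let y := flow (Y i) (- q.1 0 i) q.2 in
    rsubmx (flow (T i) (q.1 0 i) (row_mx y (push_fields s' Z (q.1, y))))
  else Z q.2.

Lemma C1at_fst q : C1at (fst : PX -> 'rV[R]_m) q.
Proof.
by apply: (@C1at_lin _ _ _ _ 1) => // v; rewrite mul1r prod_normE le_max lexx.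
Qed.

Lemma C1at_snd q : C1at (snd : PX -> 'rV[R]_n) q.
Proof.
by apply: (@C1at_lin _ _ _ _ 1) => // v; rewrite mul1r prod_normE le_max lexx orbT.
Qed.

Lemma C1at_param (i : 'I_m) q : C1at (fun q : PX => q.1 0 i : R) q.
Proof.
apply: (@C1at_lin _ _ _ _ 1) => [a u v|v]; first by rewrite !mxE.
by rewrite mul1r prod_normE le_max coord_norm_le.
Qed.

Lemma C1at_opp_param (i : 'I_m) q : C1at (fun q : PX => - q.1 0 i : R) q.
Proof.
apply: (@C1at_lin _ _ _ _ 1) => [a u v|v].
  by rewrite !mxE opprD -scalerN.
by rewrite mul1r prod_normE le_max normrN coord_norm_le.
Qed.

Lemma flow_comp0 s x : flow_comp Y s 0 x = x.
Proof. by rewrite /flow_comp; elim: s => //= i s ->; rewrite mxE flow0. Qed.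

Lemma flow_comp_inv0 s x : flow_comp_inv s (0, x) = x.
Proof.
rewrite /flow_comp_inv /=; elim: s => //= i s IH.
by rewrite mxE oppr0 flow0.
Qed.

Lemma flow_step_C1at (i : 'I_m) (f : PX -> 'rV[R]_n) q :
  q.1 = 0 -> C1at f q -> C1at (fun q => flow (Y i) (q.1 0 i) (f q)) q.
Proof.
move=> q0 fq; apply: (C1at_comp (g := fun q : R * 'rV[R]_n => flow (Y i) q.1 q.2)
  (C1at_pair (C1at_param i q) fq)).
by rewrite q0 mxE; exact: (flow_C1at (hY i)).
Qed.

Lemma flow_back_C1at (i : 'I_m) q : q.1 = 0 ->
  C1at (fun q : PX => flow (Y i) (- q.1 0 i) q.2) q.
Proof.
move=> q0; apply: (C1at_comp (g := fun q : R * 'rV[R]_n => flow (Y i) q.1 q.2)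
  (C1at_pair (C1at_opp_param i q) (C1at_snd q))).
by rewrite q0 mxE oppr0; exact: (flow_C1at (hY i)).
Qed.

Lemma flow_comp_C1at s x0 : C1at (fun q => flow_comp Y s q.1 q.2) ((0, x0) : PX).
Proof.
elim: s => [|i s IH]; first exact: C1at_snd.
exact: (flow_step_C1at i (f := fun q => flow_comp Y s q.1 q.2)).
Qed.

Lemma back_pair_C1at (i : 'I_m) x0 :
  C1at (fun q : PX => (q.1, flow (Y i) (- q.1 0 i) q.2)) (0, x0).
Proof. by apply: C1at_pair; [exact: C1at_fst|exact: flow_back_C1at]. Qed.

Lemma back_pair0 (i : 'I_m) x0 :
  ((0, flow (Y i) (- (0 : 'rV[R]_m) 0 i) x0) : PX) = (0, x0).
Proof. by rewrite mxE oppr0 flow0. Qed.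

Lemma flow_comp_inv_C1at s x0 : C1at (flow_comp_inv s) ((0, x0) : PX).
Proof.
elim: s => [|i s IH]; first exact: C1at_snd.
apply: (C1at_comp (g := flow_comp_inv s) (back_pair_C1at i x0)).
by rewrite /= back_pair0.
Qed.

Lemma push_fields_C1at s Z x0 : C1at Z x0 -> C1at (push_fields s Z) ((0, x0) : PX).
Proof.
move=> hZ; elim: s => [|i s IH].
  exact: (C1at_comp (g := Z) (C1at_snd _)).
pose b (q : PX) : PX := (q.1, flow (Y i) (- q.1 0 i) q.2).
have hb : C1at b (0, x0) by exact: back_pair_C1at.
have hp : C1at (push_fields s Z \o b) (0, x0).
  by apply: C1at_comp => //; rewrite /b /= back_pair0.
have hr : C1at (fun q => row_mx (b q).2 (push_fields s Z (b q))) (0, x0).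
  apply: (C1at_comp (g := fun q : 'rV[R]_n * 'rV[R]_n => row_mx q.1 q.2)
    (C1at_pair (C1at_comp hb (C1at_snd _)) hp)).
  apply: (@C1at_lin _ _ _ _ 1) => [a u v|v]; first by rewrite -add_row_mx scale_row_mx.
  rewrite mul1r; apply: rV_norm_le => // k; rewrite mxE prod_normE le_max.
  by case: splitP => l _; rewrite coord_norm_le ?orbT.
have hf := C1at_pair (C1at_param i (0, x0)) hr.
apply: (C1at_comp (g := fun q : R * 'rV[R]_(n + n) => rsubmx (flow (T i) q.1 q.2)) hf).
rewrite /= mxE.
apply: (C1at_comp (g := rsubmx) (flow_C1at (hT i) _)).
apply: (@C1at_lin _ _ _ _ 1); first exact: rsubmx_linear.
by move=> v; rewrite mul1r rsubmx_norm_le.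
Qed.

(** The chain rule for one more outer flow. Its spatial derivative [W] is identified with the
    tangent flow, the form in which it occurs in [push_fields]. *)
Lemma near_flow_comp (i : 'I_m) s x0 : nbhs ((0, x0) : PX) [set q : PX |
  flow_defined (Y i) (q.1 0 i) (flow_comp Y s q.1 q.2) /\
  exists W, [/\ W 0 = 0,
    forall h, W h = rsubmx (flow (T i) (q.1 0 i) (row_mx (flow_comp Y s q.1 q.2) h)) &
    forall A, sdiff (fun q : PX => flow_comp Y s q.1 q.2) q A ->
      sdiff (fun q : PX => flow_comp Y (i :: s) q.1 q.2) q
        (fun v => v.1 0 i *: Y i (flow_comp Y (i :: s) q.1 q.2) + W (A v))]].
Proof.
have hc := C1at_pair (C1at_param i (0, x0)) (flow_comp_C1at s x0).
have hn := near_flow (hY i) (flow_comp Y s 0 x0).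
have e0 : (0, flow_comp Y s 0 x0) = ((0 : 'rV[R]_m) 0 i, flow_comp Y s 0 x0).
  by rewrite mxE.
rewrite e0 in hn.
apply: filterS (C1at_near hc hn) => q /= [qd [W [hW hTW]]].
split=> //; exists W; split.
- have [fl _ _] := hW; have := lin0 fl; rewrite /= scale0r add0r; exact.
- by move=> h; rewrite (flowE (hT i) (hTW h)) row_mxKr.
move=> A hA.
have hp : sdiff (fun q : PX => q.1 0 i : R) q (fun v => v.1 0 i).
  apply: (@sdiff_lin _ _ _ _ 1) => [a u v|v]; first by rewrite !mxE.
  by rewrite mul1r prod_normE le_max coord_norm_le.
exact: (sdiff_comp (sdiff_pair hp hA) hW).
Qed.

Lemma flow_comp_deriv0 (j : 'I_m) s x0 : j \notin s ->
  nbhs ((0, x0) : PX) [set q | exists A,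
    sdiff (fun q : PX => flow_comp Y s q.1 q.2) q A /\ A (delta_mx 0 j, 0) = 0].
Proof.
elim: s => [_|i s IH].
  apply: (filterS _ filterT) => q _; exists snd; split=> //.
  by apply: (@sdiff_lin _ _ _ _ 1) => // v; rewrite mul1r prod_normE le_max lexx orbT.
rewrite inE negb_or => /andP[ji /IH h0]; have h1 := near_flow_comp i s x0.
apply: filterS (filterI h0 h1) => q [[A [hA A0]] [_ [W [W0 _ /(_ A hA) hB]]]].
eexists; split; first exact: hB.
by rewrite /= A0 W0 mxE eq_sym (negbTE ji) andbF scale0r add0r.
Qed.

Lemma flow_comp_deriv (j : 'I_m) s1 s2 x0 : j \notin s1 -> j \notin s2 ->
  nbhs ((0, x0) : PX) [set q | exists A,
    sdiff (fun q : PX => flow_comp Y (s1 ++ j :: s2) q.1 q.2) q A /\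
    A (delta_mx 0 j, 0) =
      push_fields s1 (Y j) (q.1, flow_comp Y (s1 ++ j :: s2) q.1 q.2)].
Proof.
move=> js1 js2; elim: s1 js1 => [_|i s IH].
  have h0 := flow_comp_deriv0 x0 js2; have h1 := near_flow_comp j s2 x0.
  apply: filterS (filterI h0 h1) => q [[A [hA A0]] [_ [W [W0 _ /(_ A hA) hB]]]].
  eexists; split; first exact: hB.
  by rewrite /= A0 W0 mxE !eqxx scale1r addr0.
rewrite inE negb_or => /andP[ji /IH h0]; have h1 := near_flow_comp i (s ++ j :: s2) x0.
apply: filterS (filterI h0 h1) => q [[A [hA A0]] [qd [W [W0 hW /(_ A hA) hB]]]].
eexists; split; first exact: hB.
rewrite /= A0 mxE eq_sym (negbTE ji) andbF scale0r add0r hW.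
(* [push_fields] moves its base point back along [Y i]; from a value of the whole composition this
   recovers the value of the inner one. *)
by rewrite /flow_comp /= (flowK (hY i)).
Qed.

(** An explicit preimage gives the surjectivity near [x0]; the backward flows are defined there, so
    that each forward flow cancels one of them. *)
Lemma flow_compK s x0 :
  nbhs ((0, x0) : PX) [set q | flow_comp Y s q.1 (flow_comp_inv s q) = q.2].
Proof.
elim: s => [|i s IH]; first by apply: (filterS _ filterT).
have e0 : ((0, x0) : PX) = (0, flow (Y i) (- (0 : 'rV[R]_m) 0 i) x0).
  by rewrite back_pair0.
have h0 : nbhs ((0, x0) : PX) [set q : PX |
    flow_comp Y s q.1 (flow_comp_inv s (q.1, flow (Y i) (- q.1 0 i) q.2)) =
    flow (Y i) (- q.1 0 i) q.2].
  have h := @C1at_near _ _ _ _ _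
    [set q : PX | flow_comp Y s q.1 (flow_comp_inv s q) = q.2] (back_pair_C1at i x0).
  by apply: h; rewrite /= -e0.
have h1 : nbhs ((0, x0) : PX) [set q : PX | flow_defined (Y i) (- q.1 0 i) q.2].
  have h := @C1at_near _ _ _ _ _ [set q : R * 'rV[R]_n | flow_defined (Y i) q.1 q.2]
    (C1at_pair (C1at_opp_param i (0, x0)) (C1at_snd (0, x0))).
  apply: h; rewrite /= mxE oppr0.
  by have := near_flow (hY i) x0; apply: filterS => q [].
apply: filterS (filterI h0 h1) => q [/= qE qd].
change (flow (Y i) (q.1 0 i) (flow_comp Y s q.1
  (flow_comp_inv s (q.1, flow (Y i) (- q.1 0 i) q.2))) = q.2).
by rewrite qE -[X in flow _ X](opprK (q.1 0 i)) (flowK (hY i)).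
Qed.

(** [X_j] as a function of all parameters: only flows of index below [j] enter, so later parameters
    are ignored while all fields share one domain. *)
Definition param_field (j : 'I_m) : PX -> 'rV[R]_n :=
  push_fields [seq i : 'I_m <- enum 'I_m | (i < j)%N] (Y j).

Lemma enum_ord_split (j : 'I_m) : enum 'I_m =
  [seq i : 'I_m <- enum 'I_m | (i < j)%N] ++
  j :: [seq i : 'I_m <- enum 'I_m | (j < i)%N].
Proof.
have : sorted (fun i k : 'I_m => (i < k)%N) (enum 'I_m).
  by have := iota_ltn_sorted 0 m; rewrite -val_enum_ord sorted_map; exact.
have : j \in enum 'I_m by rewrite mem_enum.
elim: (enum 'I_m) => // a s IH; rewrite inE => ja.
have tr : transitive (fun i k : 'I_m => (i < k)%N) by move=> ? ? ?; exact: ltn_trans.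
rewrite /= path_sortedE// => /andP[/allP ha ss]; case/predU1P: ja => [ja|js].
  rewrite -ja in ha *; rewrite ltnn (_ : [seq i : 'I_m <- s | (i < j)%N] = [::]) /=.
    by congr (_ :: _); apply/esym/all_filterP/allP => i; exact: ha.
  by rewrite -(filter_pred0 s); apply: eq_in_filter => i /ha /ltnW; rewrite leqNgt => /negbTE.
by rewrite (ha _ js) ltnNge (ltnW (ha _ js)) /= -IH.
Qed.

(** For [q = (p, y)] take [x] with [G (p, x) = y]. By the chain rule, [r |-> X_j(r; G (r, x))] has
    derivative [Bj (delta_mx 0 i, param_field i q)] along [t_i] at [p]. Symmetry exchanges [i] and
    [j], and linearity separates parameters from space. *)
Lemma gradient_identity (i j : 'I_m) x0 : nbhs ((0, x0) : PX) [set q |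
  forall Bi Bj, sdiff (param_field i) q Bi -> sdiff (param_field j) q Bj ->
    Bj (delta_mx 0 i, 0) + Bj (0, param_field i q) =
    Bi (delta_mx 0 j, 0) + Bi (0, param_field j q)].
Proof.
pose G (q : PX) := flow_comp Y (enum 'I_m) q.1 q.2.
have hD k : nbhs ((0, x0) : PX) [set q | exists A, sdiff G q A /\
    A (delta_mx 0 k, 0) = param_field k (q.1, G q)].
  have := @flow_comp_deriv k [seq l : 'I_m <- enum 'I_m | (l < k)%N]
    [seq l : 'I_m <- enum 'I_m | (k < l)%N] x0.
  rewrite !mem_filter !ltnn -enum_ord_split; exact.
pose N := [set q : PX |
  (exists A, sdiff G q A /\ A (delta_mx 0 i, 0) = param_field i (q.1, G q)) /\
  (exists A, sdiff G q A /\ A (delta_mx 0 j, 0) = param_field j (q.1, G q))].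
pose b (q : PX) : PX := (q.1, flow_comp_inv (enum 'I_m) q).
have hb : C1at b (0, x0) := C1at_pair (C1at_fst _) (flow_comp_inv_C1at _ x0).
(* The nested [nbhs] provides the derivative formulas on a whole neighbourhood of [(p, x)], since
   [schwarz] uses them at all parameters near [p]. *)
have hN : nbhs (b (0, x0)) [set q | nbhs q N].
  by rewrite /b flow_comp_inv0; exact: near_join (filterI (hD i) (hD j)).
have h0 := C1at_near hb hN; have h1 := flow_compK (enum 'I_m) x0.
apply: filterS (filterI h0 h1) => q [/= hq qE] Bi Bj hBi hBj; rewrite /b in hq.
set x := flow_comp_inv _ q in hq qE.
pose f r := G (r, x).
have inj_sdiff (r : 'rV[R]_m) : sdiff (fun r => (r, x) : PX) r (fun v => (v, 0)).
  exact: sdiff_pair (sdiff_id r) (sdiff_cst x r).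
have hf : \forall r \near q.1, exists A, [/\ sdiff f r A,
    A (delta_mx 0 i) = param_field i (r, f r) &
    A (delta_mx 0 j) = param_field j (r, f r)].
  have h : nbhs q.1 [set r | N (r, x)] := sdiff_cont (inj_sdiff q.1) hq.
  apply: filterS h => r [[A [hA Ai]] [A' [hA' Aj]]].
  (* The formulas for [i] and [j] come with separate derivatives of [G]; uniqueness of the
     differential merges them. *)
  have AA' : A = A' by rewrite -(sdiff_val hA) (sdiff_val hA').
  exists (fun v => A (v, 0)); split=> //; first exact: (sdiff_comp (inj_sdiff r) hA).
  by rewrite AA'.
have [A [hA Ai Aj]] := nbhs_singleton hf.
have fq : (q.1, f q.1) = q by rewrite [RHS]surjective_pairing -qE.
have hfk k B : sdiff (param_field k) q B ->
    sdiff (fun r => param_field k (r, f r)) q.1 (fun v => B (v, A v)).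
  move=> hB; apply: (sdiff_comp (sdiff_pair (sdiff_id q.1) hA)).
  by rewrite fq.
have := schwarz (hfk _ _ hBi) (hfk _ _ hBj) hf.
rewrite Ai Aj fq => S.
have split2 (B : PX -> 'rV[R]_n) u v : linear B -> B (u, 0) + B (0, v) = B (u, v).
  by move=> Bl; rewrite -(linD _ _ Bl) /=; congr (B (_, _)); rewrite ?addr0 ?add0r.
have [Bil _ _] := hBi; have [Bjl _ _] := hBj.
by rewrite !split2.
Qed.

Lemma push_fields_ext s Z (p p' : 'rV[R]_m) (y : 'rV[R]_n) :
  (forall i, i \in s -> p 0 i = p' 0 i) ->
  push_fields s Z (p, y) = push_fields s Z (p', y).
Proof.
elim: s y => //= i s IH y h.
rewrite h ?mem_head// IH// => k ks; apply: h.
by rewrite inE ks orbT.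
Qed.

End Composition.

(** * The gradient system *)

Section ParamVectors.
Context {R : realType} {m : nat}.

Lemma rV_norm_lt n (v : 'rV[R]_n) K :
  0 < K -> (forall i, `|v 0 i| < K) -> `|v| < K.
Proof.
move=> K0 vK; rewrite [ltLHS]/Num.Def.normr /= mx_normrE bigmax_lt// => -[i j] _.
by rewrite ord1.
Qed.

(** Parameters from index [j] on are set to [0], a harmless choice since [X_j] ignores them. *)
Definition extend_params (j : 'I_m) (p : 'rV[R]_j) : 'rV[R]_m :=
  \row_(i < m) oapp (fun k : 'I_j => p 0 k) 0 (insub (i : nat)).

Lemma extend_params_lt (j : 'I_m) (p : 'rV[R]_j) (i : 'I_m) (ij : (i < j)%N) :
  extend_params p 0 i = p 0 (Ordinal ij).
Proof. by rewrite mxE insubT. Qed.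

Lemma extend_paramsK (j i : 'I_m) (p : 'rV[R]_m) : (i < j)%N ->
  extend_params (params j p) 0 i = p 0 i.
Proof.
by move=> ij; rewrite (extend_params_lt _ ij) mxE; congr (p 0 _); apply: val_inj.
Qed.

Lemma extend_params_linear (j : 'I_m) : linear (@extend_params j).
Proof.
move=> a u v; apply/rowP => i; rewrite !mxE.
by case: insubP => [k _ _|_] /=; rewrite ?mxE// mulr0 addr0.
Qed.

Lemma extend_params_norm_le (j : 'I_m) (p : 'rV[R]_j) : `|extend_params p| <= `|p|.
Proof.
apply: rV_norm_le => // i; rewrite mxE.
by case: insubP => [k _ _|_] /=; rewrite ?normr0// coord_norm_le.
Qed.

Lemma extend_params_delta (j : 'I_m) (i : 'I_j) :
  extend_params (delta_mx 0 i : 'rV[R]_j) =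
  delta_mx 0 (widen_ord (ltnW (ltn_ord j)) i).
Proof.
apply/rowP => k; rewrite !mxE eqxx /=; case: insubP => [l _ lk|] /=.
  by rewrite mxE eqxx /= -!val_eqE /= lk.
by rewrite -leqNgt => jk; case: eqP => // kE; move: jk; rewrite kE /= leqNgt ltn_ord.
Qed.

End ParamVectors.

Lemma derive_along_const (R : realType) (E F : normedModType R) (f : E -> F) p v :
  (forall h : R, f (h *: v + p) = f p) -> 'D_v f p = 0.
Proof.
move=> fp; rewrite /derive; under eq_fun do rewrite /= fp subrr scaler0.
by rewrite lim_cst.
Qed.

Lemma sdiff_left (R : realType) (E E' F : normedModType R) (f : E * E' -> F) q B :
  sdiff f q B -> sdiff (fun p => f (p, q.2)) q.1 (fun v => B (v, 0)).
Proof.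
case: q => p y hf.
exact: (sdiff_comp (sdiff_pair (sdiff_id p) (sdiff_cst y p)) hf).
Qed.

Lemma sdiff_right (R : realType) (E E' F : normedModType R) (f : E * E' -> F) q B :
  sdiff f q B -> sdiff (fun y => f (q.1, y)) q.2 (fun v => B (0, v)).
Proof.
case: q => p y hf.
exact: (sdiff_comp (sdiff_pair (sdiff_cst p y) (sdiff_id y)) hf).
Qed.

Lemma lie_bracket_sdiff (R : realType) (n : nat) (Z1 Z2 : 'rV[R]_n -> 'rV[R]_n)
    y A1 A2 : sdiff Z1 y A1 -> sdiff Z2 y A2 ->
  lie_bracket Z1 Z2 y = A1 (Z2 y) - A2 (Z1 y).
Proof.
move=> h1 h2; rewrite /lie_bracket; congr (_ - _).
  exact: (congr1 (fun g => g (Z2 y)) (sdiff_val h1)).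
exact: (congr1 (fun g => g (Z1 y)) (sdiff_val h2)).
Qed.

Theorem theorem1p5p2 (R : realType) (m n : nat) (hm : (0 < m)%N)
    (hn : (0 < n)%N) (Y : 'I_m -> 'rV[R]_n -> 'rV[R]_n)
    (hY : forall j, is_Ck 2 setT (Y j)) (x0 : 'rV[R]_n) :
  exists (a : 'rV[R]_m) (V0 V : set 'rV[R]_n)
         (X : forall j : 'I_m, 'rV[R]_j -> 'rV[R]_n -> 'rV[R]_n),
    let D := box a in
    let Xsys := fun (j : 'I_m) (p : 'rV[R]_m) => X j (params j p) in
    let G := flow_comp Y (enum 'I_m) in
    (forall i, 0 < a 0 i) /\
    [/\ open V0, open V, V0 x0 & V0 `<=` V] /\
    (forall j : 'I_m,
       is_Ck 1 (box (params j a) `*` V) (fun q => X j q.1 q.2)) /\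
    (forall (p : 'rV[R]_(Ordinal hm)) y, V y ->
       X (Ordinal hm) p y = Y (Ordinal hm) y) /\
    gradient_system Xsys D V /\
    (forall (j : 'I_m) (i : 'I_j) (p : 'rV[R]_j) (y : 'rV[R]_n),
       box (params j a) p -> V y ->
       'D_(delta_mx 0 i) (fun q => X j q y) p
       = lie_bracket
           (X (widen_ord (ltnW (ltn_ord j)) i) (params i p)) (X j p) y) /\
    (* every flow entering the composition G(p; x) is defined *)
    (forall p x, D p -> V0 x -> forall j : 'I_m,
       flow_defined (Y j) (p 0 j)
         (flow_comp Y [seq i : 'I_m <- enum 'I_m | (j < i)%N] p x)) /\
    (forall x, V0 x -> is_solution Xsys D V x (fun p => G p x)).
Proof.
have hY1 j z : sdiff (Y j) z (coord_diff (Y j) z).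
  apply: is_Ck1_sdiff; have [Yd YC] := hY j; split=> // v y _.
  by have [dv _] := YC v; exact/differentiable_continuous/dv.
have [dT hT] := choice (fun jz : 'I_m * 'rV[R]_(n + n) =>
  tangent_field_sdiff (hY jz.1) jz.2).
pose dY j := coord_diff (Y j).
have {}hT j z : sdiff (tangent_field (Y j) (dY j)) z (dT (j, z)) by exact: (hT (j, z)).
pose XX := param_field Y dY.
pose G (q : 'rV[R]_m * 'rV[R]_n) := flow_comp Y (enum 'I_m) q.1 q.2.
have Y_C1 j x : C1at (Y j) x by apply: (filterS _ filterT) => z _; eexists; exact: hY1.
have XX_C1 j : C1at (XX j) (0, x0).
  exact: (@push_fields_C1at _ _ _ _ _ _ hY1 (fun i z => hT i z) _ _ _ (Y_C1 j x0)).
have near_ord (P : 'I_m -> set ('rV[R]_m * 'rV[R]_n)) :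
    (forall j, nbhs ((0 : 'rV[R]_m), x0) (P j)) ->
    nbhs ((0 : 'rV[R]_m), x0) [set q : 'rV[R]_m * 'rV[R]_n | forall j, P j q].
  by move=> h; exact: (@filter_forall _ 'I_m P _ _ h).
(* [e1] will be the radius of [V]: within it the fields are C^1 and the gradient identity holds. *)
have [e1 e10 Q1] : exists2 e, 0 < e & forall q : 'rV[R]_m * 'rV[R]_n, `|q - (0, x0)| < e ->
    (forall j, C1at (XX j) q) /\
    forall j i Bi Bj, sdiff (XX i) q Bi -> sdiff (XX j) q Bj ->
      Bj (delta_mx 0 i, 0) + Bj (0, XX i q) = Bi (delta_mx 0 j, 0) + Bi (0, XX j q).
  apply/near_norm.
  have h1 : nbhs ((0 : 'rV[R]_m), x0) [set q : 'rV[R]_m * 'rV[R]_n | forall j, C1at (XX j) q].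
    by apply: (near_ord) => j; exact: near_join (XX_C1 j).
  have h2 : nbhs ((0 : 'rV[R]_m), x0) [set q : 'rV[R]_m * 'rV[R]_n | forall j i Bi Bj,
      sdiff (XX i) q Bi -> sdiff (XX j) q Bj ->
      Bj (delta_mx 0 i, 0) + Bj (0, XX i q) = Bi (delta_mx 0 j, 0) + Bi (0, XX j q)].
    apply: (near_ord) => j; apply: (near_ord) => i.
    exact: (@gradient_identity _ _ _ _ _ _ hY1 (fun i z => hT i z)).
  by apply: filterS (filterI h1 h2) => q [? ?]; split.
(* [e2] controls parameters and initial points; it also forces the values of [G] into the ball of
   radius [e1], that is, into [V]. *)
have [e2 e20 Q2] : exists2 e, 0 < e & forall q : 'rV[R]_m * 'rV[R]_n, `|q - (0, x0)| < e ->
    [/\ forall j, flow_defined (Y j) (q.1 0 j)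
          (flow_comp Y [seq i : 'I_m <- enum 'I_m | (j < i)%N] q.1 q.2),
        C1at G q, `|G q - x0| < e1 &
        forall j, exists A, sdiff G q A /\
          A (delta_mx 0 j, 0) = XX j (q.1, G q)].
  apply/near_norm.
  have h1 : nbhs ((0 : 'rV[R]_m), x0) [set q : 'rV[R]_m * 'rV[R]_n |
      forall j, flow_defined (Y j) (q.1 0 j)
        (flow_comp Y [seq i : 'I_m <- enum 'I_m | (j < i)%N] q.1 q.2)].
    apply: (near_ord) => j.
    have := @near_flow_comp _ _ _ _ _ _ hY1 (fun i z => hT i z) j
      [seq i : 'I_m <- enum 'I_m | (j < i)%N] x0.
    by apply: filterS => q [].
  have GC : C1at G (0, x0) by exact: (flow_comp_C1at hY1).
  have h2 := near_join GC.
  have h3 : nbhs ((0 : 'rV[R]_m), x0) [set q : 'rV[R]_m * 'rV[R]_n | `|G q - x0| < e1].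
    apply: (@C1at_near _ _ _ G _ [set y | `|y - x0| < e1] GC).
    by rewrite /G /= flow_comp0; apply/(near_norm x0 (fun y => `|y - x0| < e1)); exists e1.
  have h4 : nbhs ((0 : 'rV[R]_m), x0) [set q : 'rV[R]_m * 'rV[R]_n |
      forall j, exists A, sdiff G q A /\ A (delta_mx 0 j, 0) = XX j (q.1, G q)].
    apply: (near_ord) => j.
    have := @flow_comp_deriv _ _ _ _ _ _ hY1 (fun i z => hT i z) j
      [seq l : 'I_m <- enum 'I_m | (l < j)%N]
      [seq l : 'I_m <- enum 'I_m | (j < l)%N] x0.
    by rewrite !mem_filter !ltnn -enum_ord_split; exact.
  by apply: filterS (filterI (filterI h1 h2) (filterI h3 h4)) => q [[? ?] [? ?]].
pose e := Num.min e1 e2; have e0 : 0 < e by rewrite lt_min e10.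
have XX_ext (j : 'I_m) (p p' : 'rV[R]_m) (y : 'rV[R]_n) :
    (forall i : 'I_m, (i < j)%N -> p 0 i = p' 0 i) -> XX j (p, y) = XX j (p', y).
  move=> h; apply: push_fields_ext => i; rewrite mem_filter => /andP[ij _].
  exact: h.
have XX0 q : XX (Ordinal hm) q = Y (Ordinal hm) q.2.
  rewrite /XX /param_field (_ : [seq i : 'I_m <- _ | _] = [::])//.
  by rewrite -(filter_pred0 (enum 'I_m)); apply: eq_filter => i /=; rewrite ltn0.
clearbody XX.
have XXE (j : 'I_m) p y : XX j (extend_params (params j p), y) = XX j (p, y).
  by apply: XX_ext => i; exact: extend_paramsK.
have in_ball (p : 'rV[R]_m) x d : `|p| < d -> `|x - x0| < d ->
    `|((p, x) : 'rV[R]_m * 'rV[R]_n) - (0, x0)| < d.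
  by rewrite prod_normE gt_max /= subr0 => -> ->.
have box_lt (p : 'rV[R]_m) : box (const_mx e) p -> `|p| < e.
  by move=> h; apply: rV_norm_lt => // i; have := h i; rewrite mxE ltr_norml.
have ext_box (j : 'I_m) (p : 'rV[R]_j) : box (params j (const_mx e)) p ->
    `|extend_params p| < e.
  move=> h; apply: le_lt_trans (extend_params_norm_le p) _.
  by apply: rV_norm_lt => // i; have := h i; rewrite !mxE ltr_norml.
have ee1 : e <= e1 by rewrite ge_min lexx.
have ee2 : e <= e2 by rewrite ge_min lexx orbT.
(* The box and [V0] have the common radius [e], whereas [V] keeps the radius [e1] because it has to
   contain the solutions. *)
exists (const_mx e), [set x | `|x - x0| < e], [set x | `|x - x0| < e1],
  (fun j p y => XX j (extend_params p, y)).
have ball_open d : open [set x : 'rV[R]_n | `|x - x0| < d].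
  rewrite openE => x /= xd; apply/(near_norm x (fun y => `|y - x0| < d)).
  exists (d - `|x - x0|); first by rewrite subr_gt0.
  move=> y; rewrite ltrBrDr; apply: le_lt_trans.
  by apply: (@ler_norm_split _ _ _ (y - x) (x - x0)) => //; zmod.
move=> D Xsys G'.
have XsysE : Xsys = fun j p y => XX j (p, y).
  by apply/funext => j; apply/funext => p; apply/funext => y; exact: XXE.
have grad i j p y : `|p| < e1 -> `|y - x0| < e1 ->
    'D_(delta_mx 0 i) (fun q => XX j (q, y)) p
      - 'D_(delta_mx 0 j) (fun q => XX i (q, y)) p
    = lie_bracket (fun z => XX i (p, z)) (fun z => XX j (p, z)) y.
  move=> pe ye; have [hC hG] := Q1 _ (in_ball _ _ _ pe ye).
  have [Bi hBi] := C1at_sdiff (hC i); have [Bj hBj] := C1at_sdiff (hC j).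
  have h := hG j i Bi Bj hBi hBj.
  rewrite (sdiff_derive _ (sdiff_left hBj)) (sdiff_derive _ (sdiff_left hBi)).
  rewrite (lie_bracket_sdiff (sdiff_right hBi) (sdiff_right hBj)).
  rewrite -[X in X - _](addrK (Bj (0, XX i (p, y)))) h; zmod.
split; first by move=> i; rewrite mxE.
split.
  split=> //; first by rewrite /= subrr normr0.
  by move=> x /= xe; exact: lt_le_trans ee1.
split.
  move=> j; apply: C1at_is_Ck => -[p y] [/= pb yV].
  have [hC _] := Q1 _ (in_ball _ _ _ (lt_le_trans (ext_box j p pb) ee1) yV).
  have hE : C1at (fun q : 'rV[R]_j * 'rV[R]_n =>
      (extend_params q.1, q.2) : 'rV[R]_m * 'rV[R]_n) (p, y).
    apply: (@C1at_lin _ _ _ _ 1) => [b u v|v].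
      by rewrite /= (extend_params_linear b).
    rewrite mul1r !prod_normE /= ge_max !le_max lexx orbT andbT.
    by rewrite extend_params_norm_le.
  exact: (C1at_comp hE (hC j)).
split.
  by move=> p y _; rewrite XX0.
split.
  move=> i j p y Dp Vy; rewrite XsysE; apply: grad => //.
  exact: lt_le_trans (box_lt p Dp) ee1.
split.
  move=> j i p y Dp Vy; set i' := widen_ord _ i.
  have i'j : (i' < j)%N by rewrite /i' /=.
  have pe := ext_box j p Dp.
  have pe1 := lt_le_trans pe ee1.
  have := grad i' j _ y pe1 Vy.
  (* As [i' < j], the field [XX i'] is constant along [t_j], so one parameter derivative
     survives. *)
  rewrite [X in _ - X]derive_along_const ?subr0; last first.
    move=> h; apply: XX_ext => k ki'.
    rewrite !mxE (_ : (k == j) = false) ?andbF ?mulr0 ?add0r//.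
    by apply/eqP => kj; move: (ltn_trans ki' i'j); rewrite kj ltnn.
  have [hC _] := Q1 _ (in_ball _ _ _ pe1 Vy).
  have [B hB] := C1at_sdiff (hC j).
  have hB' : sdiff (fun q => XX j (extend_params q, y)) p
      (fun v => B (extend_params v, 0)).
    apply: (sdiff_comp (f := fun q : 'rV[R]_j => extend_params q)
      (df := fun q : 'rV[R]_j => extend_params q) _ (sdiff_left hB)).
    apply: (@sdiff_lin _ _ _ _ 1); first exact: extend_params_linear.
    by move=> v; rewrite mul1r extend_params_norm_le.
  rewrite (sdiff_derive _ hB') extend_params_delta (sdiff_derive _ (sdiff_left hB)).
  (* [params i p] truncates [p] further, but both paddings agree on the indices below [i], the only
     ones that [XX i'] sees. *)
  have eZ : (fun z => XX i' (extend_params p, z)) =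
      (fun z => XX i' (extend_params (params i p : 'rV[R]_i'), z)).
    apply/funext => z; apply: XX_ext => k ki'.
    rewrite (extend_params_lt _ (ki' : (k < i)%N)).
    rewrite (extend_params_lt _ (ltn_trans ki' i'j)) mxE.
    by congr (p 0 _); apply: val_inj.
  move=> hg; apply: etrans hg _.
  exact: (congr1 (fun g => lie_bracket g (fun z => XX j (extend_params p, z)) y) eZ).
split.
  move=> p x Dp V0x j.
  by have [h _ _ _] := Q2 _ (in_ball _ _ _ (lt_le_trans (box_lt p Dp) ee2) (lt_le_trans V0x ee2)).
move=> x V0x.
have Q p (Dp : D p) :=
  Q2 _ (in_ball _ _ _ (lt_le_trans (box_lt p Dp) ee2) (lt_le_trans V0x ee2)).
split.
- apply: C1at_is_Ck => p /Q[_ hC _ _].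
  apply: (C1at_comp (f := fun p : 'rV[R]_m => (p, x)) (g := G) _ hC).
  by apply: (filterS _ filterT) => q _; eexists; exact: sdiff_pair (sdiff_id q) (sdiff_cst x q).
- by move=> p /Q[].
- exact: flow_comp0.
- move=> j p Dp; have [_ _ _ /(_ j)[A [hA Aj]]] := Q p Dp.
  by rewrite XsysE -Aj; exact: (sdiff_derive _ (sdiff_left hA)).
Qed.
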